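(* Let $r$ be a fixed positive integer. For every $n\in\mathbb N$ let $\Gamma(n)=(\Omega(n),\mathcal X(n))$ be a hypergraph all of whose edges have size at most $r$, and let $p(n)\in(0,1)$. Assume $\lim_{n\to\infty}p(n)=0$ and $\limsup_{n\to\infty}D(\Gamma(n),p(n))<\infty$. Let $X(n)$ be the number of edges of $\Gamma(n)$ fully contained in $\Omega(n)_{p(n)}$. Then for every constant $k\in\mathbb N$, as $n\to\infty$, \[\Pr[X(n)=0]=\exp\big(-\kappa_1+\kappa_2-\dots+(-1)^k\kappa_k+O(\delta_1+\Delta_{k+1})\big).\] Moreover, if $D(\Gamma(n),p(n))\le|\Omega(n)|^{-\varepsilon}$ for some constant $\varepsilon>0$ (for all sufficiently large $n$), then there is a positive integer $k=k(\varepsilon,r)$ such that $\Delta_{k+1}=o(1)$.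
   Context: For a hypergraph $\Gamma=(\Omega,\mathcal X)$ with finite vertex set $\Omega$ and $p\in(0,1)$, $\Omega_p$ is the random subset of $\Omega$ containing each element independently with probability $p$. Order the edges as $\gamma_1,\dots,\gamma_N$, let $X_i$ be the indicator of $\gamma_i\subseteq\Omega_p$, and $X_V=\prod_{i\in V}X_i$ for $V\subseteq[N]$. The dependency graph $G_\Gamma$ on $[N]$ joins $i\ne j$ iff $\gamma_i\cap\gamma_j\ne\emptyset$. $\mathcal C_k$ is the family of $k$-element $V\subseteq[N]$ with $G_\Gamma[V]$ connected. For nonempty $V$, $\kappa(V)=\sum_{\pi}(-1)^{|\pi|-1}(|\pi|-1)!\prod_{P\in\pi}\mathbb E[X_P]$ over all partitions $\pi$ of $V$ into nonempty parts. Set $\kappa_k=\sum_{V\in\mathcal C_k}\kappa(V)$, $\Delta_k=\sum_{V\in\mathcal C_k}\mathbb E[X_V]$, $\delta_1=\sum_{i\in[N]}\mathbb E[X_i]^2$. For $\Omega'\subseteq\Omega$ and $j\ge1$, $d_j(\Omega')=|\{\gamma\in\mathcal X:\Omega'\subseteq\gamma,\ |\gamma|=|\Omega'|+j\}|$, and $D(\Gamma,p)=\max_{j\ge1}\max_{\emptyset\ne\Omega'\subseteq\Omega}d_j(\Omega')p^j$. All quantities are computed for $(\Gamma(n),p(n))$; implicit constants may depend on $k$, $r$ and the sequence. *)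

(* Defs.v *)
From HB Require Import structures.
From mathcomp Require Import all_boot all_order all_algebra.
From mathcomp Require Import all_classical all_reals all_analysis.
Set Implicit Arguments.
Unset Strict Implicit.
Unset Printing Implicit Defensive.
Import Order.TTheory GRing.Theory Num.Theory.
Import numFieldNormedType.Exports.
Local Open Scope ring_scope.

(* Edges are nonempty, as usual for hypergraphs: the empty edge would lie in
   every random subset and make Pr[X = 0] vanish. *)
Record hypergraph := Hypergraph {
  vertex : finType;
  edges : {set {set vertex}};
  edges_neq0 : finset.set0 \notin edges }.

Section BinomialSubset.
Variables (R : realType) (T : finType) (p : R).

Definition binomial_weight (S : {set T}) : R :=
  \prod_(v : T) (if v \in S then p else 1 - p).

Definition Prob (A : pred {set T}) : R := \sum_(S | A S) binomial_weight S.

Definition Expect (f : {set T} -> R) : R := \sum_S binomial_weight S * f S.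

End BinomialSubset.

Section Dependency.
Variable G : hypergraph.

Definition nedges : nat := #|edges G|.

Definition edge (i : 'I_nedges) : {set vertex G} := enum_val i.

Definition count_edges (S : {set vertex G}) : nat :=
  #|[set g in edges G | g \subset S]|.

Definition dep : rel 'I_nedges :=
  [rel i j | (i != j) && (edge i :&: edge j != finset.set0)].

Definition induced (V : {set 'I_nedges}) : rel 'I_nedges :=
  [rel i j | [&& i \in V, j \in V & dep i j]].

Definition induced_connected (V : {set 'I_nedges}) : bool :=
  [forall i in V, forall j in V, connect (induced V) i j].

Definition clusters (k : nat) : {set {set 'I_nedges}} :=
  [set V : {set 'I_nedges} | (#|V| == k) && induced_connected V].

Definition codegree (j : nat) (W : {set vertex G}) : nat :=
  #|[set g in edges G | (W \subset g) && (#|g| == #|W| + j)%N]|.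

End Dependency.

Section Cumulants.
Variables (R : realType) (G : hypergraph) (p : R).

Definition indicator (i : 'I_(nedges G)) (S : {set vertex G}) : R :=
  (edge i \subset S)%:R.

Definition indicators (V : {set 'I_(nedges G)}) (S : {set vertex G}) : R :=
  \prod_(i in V) indicator i S.

Definition joint_cumulant (V : {set 'I_(nedges G)}) : R :=
  \sum_(Q : {set {set 'I_(nedges G)}} | finset.partition Q V)
    (-1) ^+ (#|Q| - 1) * ((#|Q| - 1)`!)%:R *
    \prod_(P in Q) Expect p (indicators P).

Definition kappa (k : nat) : R := \sum_(V in clusters G k) joint_cumulant V.

Definition Delta (k : nat) : R :=
  \sum_(V in clusters G k) Expect p (indicators V).

Definition delta1 : R := \sum_(i < nedges G) Expect p (indicator i) ^+ 2.

(* The terms with j > #|vertex G| vanish, and all terms are nonnegative for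
   0 < p, so truncating the range of j and starting the maximum at 0 are
   harmless (D = 0 when there are no vertices). *)
Definition D : R :=
  \big[Num.max/0]_(1 <= j < #|vertex G|.+1)
    \big[Num.max/0]_(W : {set vertex G} | W != finset.set0)
      ((codegree j W)%:R * p ^+ j).

End Cumulants.

Arguments kappa {R} G p k.
Arguments Delta {R} G p k.
Arguments delta1 {R} G p.
Arguments D {R} G p.

Local Open Scope classical_set_scope.

Definition sparse_sequence (R : realType) (r : nat)
    (G : nat -> hypergraph) (p : nat -> R) : Prop :=
  [/\ forall n (g : {set vertex (G n)}), g \in edges (G n) -> (#|g| <= r)%N,
      forall n, 0 < p n < 1,
      p n @[n --> \oo] --> 0 &
      (limn_esup (fun n => (D (G n) (p n))%:E) < +oo)%E].

(* Main.v *)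
(** Write [m V] for the joint moment [E[X_V]] and [q_V(S)] for the probability
    of [X_V = 1] given that no edge of [S] is present. Adding an edge [j] to [S]
    changes the ratio by the exact rule
      [q_V(S+j) - q_V(S) = - q_(V+j)(S) + q_V(S+j) q_j(S)],
    and the cumulants [k(V, U)] of [X_V] together with the [X_i], [i] in [U],
    obey the same rule with the product replaced by a sum over disjoint pairs.
    Telescoping over the neighbours of [V], with induction on the truncation
    order [k] and downward on [#|V|], shows that [q_V(S)] equals the alternating
    sum of the [k(V, U)] with [#|V| + #|U| <= k], up to the clusters of size
    [k + 1] and to products of moments of overlapping clusters; an overlap costs
    an extra factor [E[X_x]]. Since [1 - q_i(S)] is the ratio of consecutive
    avoidance probabilities, summing logarithms gives the expansion, and the
    bound on the codegrees turns the overlap terms into [O(delta1)].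

    For the second part, [p] is replaced by [p / y] with [y = |Omega|^(-eps/r)]:
    the codegrees stay bounded, so the rescaled cluster sums grow at most
    polynomially, while a cluster of [2 ^ L] edges covers at least [L] vertices
    and gains a factor [y ^ L]. *)
Require Import Defs.
From mathcomp Require Import all_boot all_order all_algebra.
From mathcomp Require Import ring lra zify.
From mathcomp Require Import reals exp.
Set Implicit Arguments.
Unset Strict Implicit.
Unset Printing Implicit Defensive.
Import Order.TTheory GRing.Theory Num.Theory.
Local Open Scope ring_scope.

(** * Convolution of set functions and cumulants *)

Section SetConvolution.
Variables (R : comNzRingType) (I : finType).
Implicit Types (f g h m : {set I} -> R) (A B U V : {set I}) (i j : I).

(** Multiplication in R[x_i]/(x_i^2), with [f A] as the coefficient of the squarefree monomial of
    [A]. *)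
Definition conv f g U : R := \sum_(A : {set I} | A \subset U) f A * g (U :\: A).

Lemma big_subset_setU1 f U j : j \notin U ->
  \sum_(A : {set I} | A \subset j |: U) f A =
  \sum_(A : {set I} | A \subset U) f A + \sum_(A : {set I} | A \subset U) f (j |: A).
Proof.
move=> jU; rewrite (bigID (fun A : {set I} => j \in A)) /= addrC; congr (_ + _).
  apply: eq_bigl => A; apply/andP/idP => [[AjU jA]|AU].
    by rewrite -(setU1K jU) subsetD1 AjU jA.
  split; first by apply: subset_trans AU (subsetUr _ _).
  by apply: contra jU => /(subsetP AU).
rewrite (reindex_onto (fun A => j |: A) (fun A => A :\ j)) /=; last first.
  by move=> A /andP[_ jA]; rewrite setD1K.
apply: eq_bigl => A; rewrite setU11 andbT; apply/andP/idP => [[AU /eqP <-]|AU].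
  by rewrite -(setU1K jU) setSD.
rewrite setUS //; split=> //; apply/eqP/setU1K.
by apply: contra jU => /(subsetP AU).
Qed.

Lemma convC f g U : conv f g U = conv g f U.
Proof.
rewrite /conv (reindex_onto (fun A => U :\: A) (fun A => U :\: A)) /=; last first.
  by move=> A AU; rewrite setDDr setDv set0U; apply/setIidPr.
rewrite [LHS](eq_bigl (fun A : {set I} => A \subset U)).
  apply: eq_bigr => A AU; rewrite mulrC; congr (g _ * _).
  by rewrite setDDr setDv set0U; apply/setIidPr.
move=> A; rewrite subsetDl /= setDDr setDv set0U.
by apply/eqP/setIidPr.
Qed.

Lemma convA f g h U : conv f (conv g h) U = conv (conv f g) h U.
Proof.
rewrite /conv; under [RHS]eq_bigr => C _ do rewrite mulr_suml.
rewrite [RHS](exchange_big_dep (fun A : {set I} => A \subset U)) /=; last first.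
  by move=> C A CU sAC; apply: subset_trans CU.
apply: eq_bigr => A AU; rewrite mulr_sumr.
rewrite [RHS](reindex_onto (fun B => A :|: B) (fun C => C :\: A)) /=; last first.
  by move=> C /andP[_ /setIidPr sAC]; rewrite -{2}(setID C A) sAC.
rewrite [RHS](eq_bigl (fun B : {set I} => B \subset U :\: A)).
  apply: eq_bigr => B; rewrite subsetD => /andP[BU dAB].
  rewrite setDUl setDv set0U mulrA; congr (_ * g _ * h _).
    by apply/esym/setDidPl.
  by rewrite setDDl.
move=> B; rewrite subsetUl andbT subUset AU subsetD /=.
rewrite setDUl setDv set0U; congr andb.
by apply/eqP/idP => [/setDidPl|dBA]; last apply/setDidPl.
Qed.

Lemma eq_conv f1 f2 g1 g2 U : f1 =1 f2 -> g1 =1 g2 -> conv f1 g1 U = conv f2 g2 U.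
Proof. by move=> ef eg; apply: eq_bigr => A _; rewrite ef eg. Qed.

Lemma eq_convr f g1 g2 U : {in [pred A : {set I} | A \subset U], g1 =1 g2} ->
  conv f g1 U = conv f g2 U.
Proof. by move=> eg; apply: eq_bigr => A _; rewrite eg // inE subsetDl. Qed.

Lemma convN f g U : conv f (fun A => - g A) U = - conv f g U.
Proof. by rewrite /conv -sumrN; apply: eq_bigr => A _; rewrite mulrN. Qed.

Lemma conv1 f U : conv f (fun B => (B == set0)%:R) U = f U.
Proof.
rewrite /conv (bigD1 U) //= setDv eqxx mulr1 big1 ?addr0 // => A /andP[AU neAU].
rewrite setD_eq0 (_ : U \subset A = false) ?mulr0 //.
by apply: contraNF neAU => UA; rewrite eqEsubset AU.
Qed.

Lemma conv_set0 f g : conv f g set0 = f set0 * g set0.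
Proof.
rewrite /conv (big_pred1 set0) ?setDv // => A.
by rewrite subset0.
Qed.

(** Leibniz rule: [fun A => f (j |: A)] is the derivative of [f] in the variable of [j]. *)
Lemma conv_setU1 f g U j : j \notin U ->
  conv f g (j |: U) =
  conv (fun A => f (j |: A)) g U + conv f (fun A => g (j |: A)) U.
Proof.
move=> jU; rewrite {1}/conv.
rewrite (@big_subset_setU1 (fun A => f A * g ((j |: U) :\: A))) // addrC.
congr (_ + _); apply: eq_bigr => A AU; congr (_ * g _).
  rewrite -setDDl; congr (_ :\: _); exact: setU1K.
rewrite setDUl; congr (_ :|: _); apply/setDidPl.
by rewrite disjoints1; apply: contra jU => /(subsetP AU).
Qed.

Lemma notin_partition (Q : {set {set I}}) U A :
  A != set0 -> partition Q (U :\: A) -> A \notin Q.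
Proof.
move=> /set0Pn[x xA] pQ; apply/negP => AQ.
have : x \in U :\: A by rewrite -(cover_partition pQ); apply/bigcupP; exists A.
by rewrite inE xA.
Qed.

Lemma big_partition_block (F : {set {set I}} -> R) U A :
  A != set0 -> A \subset U ->
  \sum_(Q : {set {set I}} | partition Q U && (A \in Q)) F Q =
  \sum_(Q : {set {set I}} | partition Q (U :\: A)) F (A |: Q).
Proof.
move=> A0 AU; rewrite (reindex_onto (fun Q => A |: Q) (fun Q => Q :\ A)) /=; last first.
  by move=> Q /andP[_ AQ]; rewrite setD1K.
apply: eq_bigl => Q; rewrite setU11 andbT; apply/andP/idP => [[pQ /eqP AQ]|pQ].
  have AnQ : A \notin Q by rewrite -AQ setD11.
  by rewrite -AQ; apply: partitionD1 pQ _; rewrite setU11.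
have AnQ := notin_partition A0 pQ.
rewrite setU1K //; split=> //.
rewrite -(setID U A) (setIidPr AU); apply: partitionU1 => //.
by rewrite disjoint_sym disjoints_subset subsetDr.
Qed.

(** The reciprocal of [m] for [conv] when [m set0 = 1]: in the geometric series in 1 - m the n-th
    power runs over ordered partitions into n blocks, hence the factorial. *)
Definition conv_inv m U : R :=
  \sum_(Q : {set {set I}} | partition Q U)
    (-1) ^+ #|Q| * (#|Q|`!)%:R * \prod_(P in Q) m P.

Lemma conv_inv0 m : conv_inv m set0 = 1.
Proof.
rewrite /conv_inv (big_pred1 set0) ?cards0 ?expr0 ?big_set0 ?mulr1 //.
by move=> Q; rewrite partition_set0.
Qed.

(** A nonempty [A] with a partition of [U :\: A] is a partition [Q] of [U] with a marked block. The
    [#|Q|] possible marks turn (n-1)! into n!, which cancels the term [A = set0]. *)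
Lemma conv_invP m U : m set0 = 1 -> conv m (conv_inv m) U = (U == set0)%:R.
Proof.
move=> m0; have [->|U0] := eqVneq U set0.
  by rewrite conv_set0 m0 mul1r conv_inv0.
rewrite /conv (bigD1 set0) ?sub0set //= m0 mul1r setD0.
rewrite {1}/conv_inv; apply/eqP; rewrite addrC addr_eq0; apply/eqP.
rewrite (eq_bigr (fun A => \sum_(Q : {set {set I}} | partition Q U && (A \in Q))
   (-1) ^+ #|Q|.-1 * (#|Q|.-1)`!%:R * \prod_(P in Q) m P)); last first.
  move=> A /andP[AU A0]; rewrite big_partition_block // mulr_sumr.
  apply: eq_bigr => Q pQ; have AQ := notin_partition A0 pQ.
  rewrite cardsU1 AQ /= big_setU1 //= [RHS]mulrCA; congr (_ * _).
rewrite (exchange_big_dep (fun Q : {set {set I}} => partition Q U)) /=; last first.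
  by move=> A Q _ /andP[].
rewrite -sumrN; apply: eq_bigr => Q pQ.
rewrite (eq_bigl (fun A => A \in Q)); last first.
  move=> A; rewrite pQ /=; have [AQ|] := boolP (A \in Q); last by rewrite andbF.
  rewrite andbT; apply/andP; split.
    by rewrite -(cover_partition pQ); apply: bigcup_sup AQ.
  by apply: contraTneq AQ => ->; case/and3P: pQ.
rewrite sumr_const.
have : #|Q| != 0%N.
  apply: contra_neq U0 => /eqP; rewrite cards_eq0 => /eqP Q0.
  by rewrite -(cover_partition pQ) Q0 /cover big_set0.
case: #|Q| => // n _ /=; rewrite factS natrM exprS mulN1r !mulNr opprK !mulrA.
by rewrite -[LHS]mulr_natl !mulrA [n.+1%:R * _]mulrC.
Qed.

End SetConvolution.

Section MixedCumulant.
Variables (R : comNzRingType) (I : finType) (m : {set I} -> R).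
Hypothesis m0 : m set0 = 1.
Implicit Types (A B U V : {set I}) (i j : I).

(* The joint cumulant of the variable [X_V] (one argument) and the [X_i],
   [i \in U], when [m] gives the joint moments. *)
Definition ccum V U : R := conv (fun A => m (V :|: A)) (conv_inv m) U.

Lemma ccum0 V : ccum V set0 = m V.
Proof. by rewrite /ccum conv_set0 setU0 conv_inv0 mulr1. Qed.

(** Derivative of a reciprocal, (1/m)' = -(1/m)(m'/m), where m'/m is [ccum m [set j]]. *)
Lemma conv_inv_setU1 U j : j \notin U ->
  conv_inv m (j |: U) = - conv (conv_inv m) (ccum [set j]) U.
Proof.
pose w := conv_inv m; move=> jU.
(* This differentiates the identity m (1/m) = 1 in the variable of [j]. *)
have H B : B \subset U -> conv m (fun A => w (j |: A)) B = - ccum [set j] B.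
  move=> BU; apply/eqP; rewrite -addr_eq0 addrC /ccum -conv_setU1; last first.
    by apply: contra jU => /(subsetP BU).
  by rewrite conv_invP // -cards_eq0 cardsU1; case: (j \in B) (contra (subsetP BU j) jU).
rewrite -/w -[LHS](@conv1 _ _ (fun A => w (j |: A))) convC.
transitivity (conv (conv w m) (fun A => w (j |: A)) U).
  by apply: eq_conv => // B; rewrite convC conv_invP.
by rewrite -convA -convN; apply: eq_convr => A; rewrite inE; apply: H.
Qed.

(** Quotient rule for m(V + .)/m, the series with coefficients [ccum V U]. *)
Lemma ccumS V U j : j \notin U ->
  ccum V (j |: U) = ccum (j |: V) U - conv (ccum V) (ccum [set j]) U.
Proof.
move=> jU; rewrite /ccum conv_setU1 //; congr (_ + _).
  by apply: eq_conv => // A; rewrite setUCA setUA.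
rewrite -[X in _ = - X]convA -convN; apply: eq_convr => A; rewrite inE => AU.
by apply: conv_inv_setU1; apply: contra (subsetP AU j) jU.
Qed.

End MixedCumulant.

(** * Connected sets and cuts *)

Section Connectivity.
Variables (I : finType) (e : rel I).
Hypothesis e_sym : symmetric e.
Implicit Types (A B U V W : {set I}) (i j : I).

Definition separated A B := [forall i in A, forall j in B, ~~ e i j].

Lemma separatedP A B :
  reflect (forall i j, i \in A -> j \in B -> ~~ e i j) (separated A B).
Proof.
apply: (iffP idP) => [/forall_inP H i j iA jB|H].
  by move/forall_inP: (H i iA) => /(_ j jB).
by apply/forall_inP => i iA; apply/forall_inP => j jB; apply: H.
Qed.

Lemma separatedC A B : separated A B = separated B A.
Proof.
by apply/separatedP/separatedP => H i j iA jB; rewrite e_sym; apply: H.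
Qed.

Lemma separatedS A B A' B' :
  A' \subset A -> B' \subset B -> separated A B -> separated A' B'.
Proof.
move=> /subsetP sA /subsetP sB /separatedP H; apply/separatedP => i j iA jB.
by apply: H; [apply: sA | apply: sB].
Qed.

(** Connectivity by cuts rather than paths, the form that splits off an independent part directly;
    the empty set counts as connected. *)
Definition conn W := [forall A : {set I},
  [&& A \subset W, A != set0 & A != W] ==> ~~ separated A (W :\: A)].

Lemma connPn W : ~~ conn W ->
  exists A, [/\ A \subset W, A != set0, A != W & separated A (W :\: A)].
Proof.
case/forallPn => A; rewrite negb_imply negbK => /andP[/and3P[? ? ?] ?].
by exists A.
Qed.

Lemma conn_cut W A V : conn V -> V \subset W -> separated A (W :\: A) ->
  V \subset A \/ [disjoint V & A].
Proof.
move=> /forallP/(_ (V :&: A)) cV VW sA.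
have [/eqP VA0|VA0] := boolP (V :&: A == set0); first by right; rewrite -setI_eq0 VA0.
have [/eqP/setIidPl VA|VA] := boolP (V :&: A == V); first by left.
move: cV; rewrite subsetIl VA0 VA /=; case/negP.
apply: separatedS sA; first exact: subsetIr.
by rewrite setDIr setDv set0U setSD.
Qed.

Lemma conn1 i : conn [set i].
Proof.
apply/forallP => A; apply/implyP => /and3P[].
by rewrite subset1 => /orP[->|->]; rewrite ?andbF.
Qed.

Lemma connU V W i j : conn V -> conn W -> i \in V -> j \in W ->
  (i == j) || e i j -> conn (V :|: W).
Proof.
move=> cV cW iV jW ij; apply/negPn/negP => /connPn[A [AVW A0 neA sA]].
have [VA|dVA] := conn_cut cV (subsetUl V W) sA;
have [WA|dWA] := conn_cut cW (subsetUr V W) sA.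
- by move: neA; rewrite eqEsubset AVW subUset VA WA.
- have iA := subsetP VA i iV; have jA := disjointFr dWA jW.
  have := separatedP _ _ sA i j iA; rewrite !inE jA jW orbT => /(_ isT) ne.
  by move: ij; rewrite (negbTE ne) orbF => /eqP ij; rewrite -ij iA in jA.
- have iA := disjointFr dVA iV; have jA := subsetP WA j jW.
  have := separatedP _ _ sA j i jA; rewrite !inE iA iV => /(_ isT) ne.
  by move: ij; rewrite e_sym (negbTE ne) orbF => /eqP ij; rewrite -ij iA in jA.
- case/set0Pn: A0 => x xA; move: (subsetP AVW x xA); rewrite inE => /orP[xV|xW].
    by rewrite (disjointFr dVA xV) in xA.
  by rewrite (disjointFr dWA xW) in xA.
Qed.

(** The connected set [V] lies on one side of a cut of [V :|: U], so the other side is contained in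
    [U]. *)
Lemma conn_split V U : conn V -> V != set0 -> ~~ conn (V :|: U) ->
  exists U2, [/\ U2 \subset U, U2 != set0, [disjoint V & U2]
    & separated (V :|: U :\: U2) U2].
Proof.
move=> cV V0 /connPn[A [AVU A0 neA sA]].
have [VA|dVA] := conn_cut cV (subsetUl V U) sA.
  exists ((V :|: U) :\: A); split.
  - by apply/subsetP => x; rewrite !inE => /andP[xA /orP[/(subsetP VA)|//]]; rewrite (negbTE xA).
  - by rewrite setD_eq0; apply: contra neA => h; rewrite eqEsubset AVU.
  - by rewrite disjoints_subset; apply/subsetP => x /(subsetP VA) xA; rewrite !inE xA.
  apply: separatedS sA => //; apply/subsetP => x; rewrite !inE => /orP[/(subsetP VA)//|].
  by case/andP => + xU; rewrite xU orbT andbT negbK.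
exists A; split=> //.
- apply/subsetP => x xA; move: (subsetP AVU x xA); rewrite inE => /orP[xV|//].
  by rewrite (disjointFr dVA xV) in xA.
- rewrite separatedC; apply: separatedS sA => //; apply/subsetP => x; rewrite !inE.
  by case/orP => [xV|/andP[-> ->]]; rewrite ?orbT // xV (disjointFr dVA xV).
Qed.

Lemma conn_extend W W' : conn W -> W' \proper W -> W' != set0 ->
  exists i j, [/\ i \in W', j \in W :\: W' & e i j].
Proof.
move=> /forallP/(_ W') cW /properP[W'W [x xW xW']] W'0.
have : ~~ separated W' (W :\: W').
  apply: (implyP cW); rewrite W'W W'0 /=; apply: contraNneq xW' => ->.
  exact: xW.
case/forallPn => i; rewrite negb_imply => /andP[iW' /forallPn[j]].
by rewrite negb_imply negbK => /andP[jW eij]; exists i, j.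
Qed.

End Connectivity.

(** * Cluster models *)

Lemma ler_sum_inj (R : numDomainType) (J K : finType) (P : pred J) (Q : pred K)
    (h : J -> K) (f : K -> R) :
  {in P &, injective h} -> (forall a, P a -> Q (h a)) ->
  (forall b, Q b -> 0 <= f b) ->
  \sum_(a | P a) f (h a) <= \sum_(b | Q b) f b.
Proof.
move=> h_inj hPQ f0.
rewrite -(big_imset f (h := h) (A := P)) //.
rewrite [leRHS](bigID (mem (h @: P))) /= [X in X + _](eq_bigl (mem (h @: P))).
  by rewrite lerDl sumr_ge0 // => b /andP[/f0].
by move=> b /=; apply: andb_idl => /imsetP[a aP ->]; apply: hPQ.
Qed.

Lemma ler_sum_sub (R : numDomainType) (J : finType) (P Q : pred J) (f : J -> R) :
  (forall a, P a -> Q a) -> (forall b, Q b -> 0 <= f b) ->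
  \sum_(a | P a) f a <= \sum_(b | Q b) f b.
Proof. by move=> sPQ f0; apply: (ler_sum_inj (h := id)). Qed.

Lemma card_subsets (I : finType) (U : {set I}) :
  #|[pred A : {set I} | A \subset U]| = (2 ^ #|U|)%N.
Proof. by rewrite -card_powerset; apply: eq_card => A; rewrite !inE. Qed.

Section ClusterModel.
Variables (R : realFieldType) (I : finType) (e : rel I) (m : {set I} -> R).
Implicit Types (A B C S U V W : {set I}) (i j x : I).

(* [m V] plays the role of the joint moment [E[X_V]]. *)
Record cluster_model : Prop := ClusterModel {
  dep_sym : symmetric e;
  moment0 : m set0 = 1;
  moment_ge0 : forall A, 0 <= m A;
  moment_anti : forall A B, A \subset B -> m B <= m A;
  moment_supermodular : forall A B, m A * m B <= m (A :|: B) * m (A :&: B);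
  moment_indep : forall A B, separated e A B -> [disjoint A & B] ->
    m (A :|: B) = m A * m B }.

Hypothesis model : cluster_model.
Let e_sym := dep_sym model.
Let m0 := moment0 model.
Let m_ge0 := moment_ge0 model.
Let m_anti := moment_anti model.

Lemma moment_le1 A : m A <= 1.
Proof. by rewrite -m0 m_anti // sub0set. Qed.

(** Supermodularity leaves the moment of [A :&: B], which contains [x]; this is the gain from an
    overlap. *)
Lemma moment_overlap A B x : x \in A -> x \in B ->
  m A * m B <= m (A :|: B) * m [set x].
Proof.
move=> xA xB; apply: le_trans (moment_supermodular model A B) _.
by rewrite ler_wpM2l // m_anti // sub1set inE xA.
Qed.

Lemma momentM_le A B : m A * m B <= m (A :|: B).
Proof.
apply: le_trans (moment_supermodular model A B) _.
by rewrite ler_piMr // moment_le1.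
Qed.

(** Cumulants vanish across independent groups. By [ccumS] the elements of [U1] are removed one by
    one; for empty [U1] the moment of [V] factors out and [m] convolved with its reciprocal
    remains. *)
Lemma ccum_separated V U1 U2 : U2 != set0 -> [disjoint V :|: U1 & U2] ->
  separated e (V :|: U1) U2 -> ccum m V (U1 :|: U2) = 0.
Proof.
move: {2}#|U1| (leqnn #|U1|) => n; elim: n V U1 U2 => [|n IHn] V U1 U2.
  rewrite leqn0 cards_eq0 => /eqP ->; rewrite setU0 set0U => U20 dV sV.
  rewrite /ccum /conv (eq_bigr (fun A => m V * (m A * conv_inv m (U2 :\: A)))).
    by rewrite -mulr_sumr -/(conv _ _ _) conv_invP // (negbTE U20) mulr0.
  move=> A AU; rewrite (moment_indep model) ?mulrA //.
    exact: separatedS sV.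
  exact: disjointWr AU dV.
move=> leU1 U20 dVU sVU; have [U10|/set0Pn[j jU1]] := eqVneq U1 set0.
  by apply: IHn; rewrite // U10 cards0.
have jU2 : j \notin U2 by rewrite (disjointFr dVU) // inE jU1 orbT.
have {1}-> : U1 = j |: (U1 :\ j) by rewrite setD1K.
have leD : (#|U1 :\ j| <= n)%N by move: leU1; rewrite (cardsD1 j) jU1.
have sub B : B \subset U1 :\ j :|: U2 -> B = (B :&: (U1 :\ j)) :|: (B :&: U2).
  by move=> sB; rewrite -setIUr; apply/esym/setIidPl.
have sub1 B C : B \subset U1 -> C \subset U2 -> C != set0 ->
  (#|B| <= n)%N -> ccum m V (B :|: C) = 0.
  move=> BU CU C0 leB; apply: IHn => //.
    exact: (disjointW (setUS V BU) CU).
  exact: (separatedS (setUS V BU) CU).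
have sub2 B C : B \subset U1 -> C \subset U2 -> C != set0 ->
  (#|B| <= n)%N -> ccum m [set j] (B :|: C) = 0.
  move=> BU CU C0 leB.
  have BV : j |: B \subset V :|: U1.
    by rewrite subUset sub1set inE jU1 orbT (subset_trans BU) ?subsetUr.
  apply: IHn => //.
    exact: (disjointW BV CU).
  exact: (separatedS BV CU).
have leI B : (#|B :&: (U1 :\ j)| <= n)%N.
  by apply: leq_trans leD; apply/subset_leq_card/subsetIr.
have sI B : B :&: (U1 :\ j) \subset U1.
  by apply: subset_trans (subsetIr _ _) (subsetDl _ _).
rewrite -setUA ccumS //; last by rewrite !inE eqxx.
rewrite IHn //; last 2 first.
- by rewrite (_ : _ :|: _ = V :|: U1) // -setUA setUCA setD1K.
- by rewrite (_ : _ :|: _ = V :|: U1) // -setUA setUCA setD1K.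
rewrite sub0r /conv big1 ?oppr0 // => A AU.
(* Either [A] meets [U2] and the first factor vanishes by induction, or all of [U2] goes to the
   second factor, which then vanishes. *)
have [A20|A20] := eqVneq (A :&: U2) set0; last first.
  by rewrite (sub A) // sub1 ?mul0r // subsetIr.
rewrite [X in _ * ccum _ _ X](sub _ (subsetDl _ _)) sub2 ?mulr0 ?subsetIr //.
rewrite (_ : _ :&: U2 = U2) //; apply/setP => x; move/setP/(_ x): A20.
by rewrite !inE; case: (x \in A); case: (x \in U2); rewrite ?orbT ?andbF.
Qed.

Lemma ccum_eq0 V U : conn e V -> V != set0 -> ~~ conn e (V :|: U) ->
  ccum m V U = 0.
Proof.
move=> cV V0 ncVU; have [U2 [U2U U20 dV sV]] := conn_split e_sym cV V0 ncVU.
rewrite -(setID U U2) (setIidPr U2U) setUC; apply: ccum_separated => //.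
by rewrite -setI_eq0 setIUl setU_eq0 !setI_eq0 dV /= disjoints_subset setDE subsetIr.
Qed.

(** The recursion follows [ccumS]: the power of 2 counts the ways to split the remaining set between
    the two cumulants. *)
Fixpoint ccum_bound n : R :=
  if n is n'.+1 then ccum_bound n' + 2 ^+ n' * ccum_bound n' ^+ 2 else 1.

Lemma ccum_bound_ge1 n : 1 <= ccum_bound n.
Proof.
elim: n => //= n IH; rewrite ler_wpDr // mulr_ge0 ?exprn_ge0 //.
exact: le_trans IH.
Qed.

Lemma ccum_bound_ge0 n : 0 <= ccum_bound n.
Proof. exact: le_trans (ccum_bound_ge1 n). Qed.

(** Both terms of [ccumS] are bounded by induction; the product of the two moments is merged into
    one by positive correlation. *)
Lemma ccum_le V U n : (#|U| <= n)%N ->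
  `|ccum m V U| <= ccum_bound n * m (V :|: U).
Proof.
elim: n V U => [|n IHn] V U leU.
  move: leU; rewrite leqn0 cards_eq0 => /eqP->.
  by rewrite ccum0 setU0 mul1r ger0_norm.
have [->|/set0Pn[j jU]] := eqVneq U set0.
  by rewrite ccum0 setU0 ger0_norm // ler_peMl // ccum_bound_ge1.
have leD : (#|U :\ j| <= n)%N by move: leU; rewrite (cardsD1 j) jU.
rewrite -(setD1K jU) ccumS ?setD11 //= mulrDl (le_trans (ler_normB _ _)) //.
apply: lerD; first by apply: le_trans (IHn _ _ leD) _; rewrite setUCA setUA.
apply: le_trans (ler_norm_sum _ _ _) _.
apply: (@le_trans _ _ (\sum_(A : {set I} | A \subset U :\ j)
   ccum_bound n ^+ 2 * m (V :|: (j |: U :\ j)))).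
  apply: ler_sum => A AU; rewrite normrM.
  have leA : (#|A| <= n)%N by apply: leq_trans leD; apply: subset_leq_card.
  have leA' : (#|(U :\ j) :\: A| <= n)%N.
    by apply: leq_trans leD; apply/subset_leq_card/subsetDl.
  apply: le_trans (ler_pM (normr_ge0 _) (normr_ge0 _) (IHn _ _ leA) (IHn _ _ leA')) _.
  rewrite mulrACA -expr2 ler_wpM2l ?exprn_ge0 ?ccum_bound_ge0 //.
  apply: le_trans (momentM_le _ _) _; rewrite le_eqVlt; apply/orP; left.
  apply/eqP; congr m; rewrite setUACA setUA setUA -setUA.
  rewrite -(setUA V) -(setUA V) [_ :|: (_ :\: A)](_ : _ = U :\ j) //.
  by rewrite -{2}(setID (U :\ j) A) (setIidPr AU).
rewrite sumr_const -[leLHS]mulr_natl mulrA ler_wpM2r // ler_wpM2r ?exprn_ge0 ?ccum_bound_ge0 //.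
by rewrite -natrX ler_nat card_subsets leq_exp2l.
Qed.

End ClusterModel.

(** * Error terms as sums over clusters *)

Section ClusterError.
Variables (R : realFieldType) (I : finType) (e : rel I) (m : {set I} -> R).
Implicit Types (A B C S U V W : {set I}) (i j x : I) (k : nat).
Hypothesis model : cluster_model e m.
Let e_sym := dep_sym model.
Let m_ge0 := moment_ge0 model.

(** Dominates [m [set x]] for an overlap at any [x] of [W]; being a sum, it can later be exchanged
    with the sum over clusters. *)
Definition mu W : R := \sum_(x in W) m [set x].

Definition phi k W : R :=
  if #|W| == k.+1 then 1 else if (#|W| <= k)%N then mu W else 0.

(* Clusters of size [k + 1] contribute to [Delta_(k+1)]; the smaller ones carry
   the extra factor [mu], which turns their sum into a multiple of [delta1]. *)
Definition err k V : R := \sum_(W : {set I} | (V \subset W) && conn e W) m W * phi k W.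

Definition adj V j := [exists i in V, e i j].

Lemma mu_ge0 W : 0 <= mu W. Proof. exact: sumr_ge0. Qed.

Lemma mu_sub A B : A \subset B -> mu A <= mu B.
Proof. by move=> AB; apply: ler_sum_sub => // x; apply: (subsetP AB). Qed.

Lemma le_mu x W : x \in W -> m [set x] <= mu W.
Proof. by move=> xW; rewrite /mu (bigD1 x) //= lerDl sumr_ge0. Qed.

Lemma phi_ge0 k W : 0 <= phi k W.
Proof. by rewrite /phi; do 2!case: ifP => // _; rewrite mu_ge0. Qed.

Lemma phi_small k W : (#|W| <= k)%N -> phi k W = mu W.
Proof. by move=> leW; rewrite /phi leW ltn_eqF. Qed.

Let F k W : R := m W * phi k W.
Let F_ge0 k W : 0 <= F k W. Proof. by rewrite mulr_ge0 ?phi_ge0. Qed.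

Let F_gt k W : (k.+1 < #|W|)%N -> F k W = 0.
Proof. by move=> gtW; rewrite /F /phi gtn_eqF // leqNgt (ltnW gtW) mulr0. Qed.

Lemma err_ge0 k V : 0 <= err k V.
Proof. by apply: sumr_ge0 => W _; apply: F_ge0. Qed.

(** If [W] has size [b + 1], either the union has size [k + 1] and weight 1, or [V] and [W] overlap
    and the common point supplies the factor [mu]. A smaller [W] already carries that factor. *)
Lemma moment_merge k b V W : (#|V| + b = k)%N ->
  m V * (m W * phi b W) <= m (V :|: W) * phi k (V :|: W).
Proof.
move=> Vb; rewrite mulrA.
have leU : (#|V :|: W| <= #|V| + #|W|)%N by rewrite cardsU leq_subr.
rewrite {1}/phi; case: eqP => [Wb|_]; last first.
  case: leqP => Wb; last by rewrite mulr0 F_ge0.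
  rewrite phi_small; last by rewrite (leq_trans leU) // -Vb leq_add2l.
  by apply: ler_pM; rewrite ?mulr_ge0 ?mu_ge0 ?(momentM_le model) ?mu_sub ?subsetUr.
rewrite mulr1; rewrite {1}/phi; case: eqP => [_|neW].
  by rewrite mulr1 (momentM_le model).
have leW : (#|V :|: W| <= k)%N.
  by rewrite -ltnS ltn_neqAle; apply/andP; split; [exact/eqP | lia].
rewrite leW; have /set0Pn[x] : V :&: W != set0.
  by rewrite -card_gt0; move: (cardsUI V W); lia.
rewrite inE => /andP[xV xW]; apply: le_trans (moment_overlap model xV xW) _.
by rewrite ler_wpM2l // le_mu // inE xV.
Qed.

Lemma moment_merge_overlap k V W x : (#|V| + #|W| <= k)%N ->
  x \in V -> x \in W -> m V * m W <= m (V :|: W) * phi k (V :|: W).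
Proof.
move=> leVW xV xW; apply: le_trans (moment_overlap model xV xW) _.
rewrite phi_small; last by apply: leq_trans leVW; rewrite cardsU leq_subr.
by rewrite ler_wpM2l // le_mu // inE xV.
Qed.

(** Common bound for the errors created when [j] joins the conditioning set: one cluster grows from
    [V], another from [j], and they may overlap. *)
Definition pair_err k V j : R :=
  \sum_(W1 : {set I} | (V \subset W1) && conn e W1) \sum_(W2 : {set I} | (j \in W2) && conn e W2)
    m (W1 :|: W2) * phi k (W1 :|: W2).

Lemma err1_le_pair k V j : 
  \sum_(W : {set I} | (V \subset W) && conn e W) m (j |: W) * phi k (j |: W) <= pair_err k V j.
Proof.
apply: ler_sum => W _; rewrite setUC (bigD1 [set j]) /=; last by rewrite set11 conn1.
by rewrite lerDl sumr_ge0 // => W2 _; apply: F_ge0.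
Qed.

Lemma err_setU1_le_pair k V j : err k (j |: V) <= pair_err k V j.
Proof.
apply: le_trans (err1_le_pair k V j).
rewrite /err [leLHS](eq_bigr (fun W : {set I} => F k (j |: W))); last first.
  move=> W /andP[]; rewrite subUset sub1set => /andP[jW _] _.
  by have /setUidPr -> : [set j] \subset W by rewrite sub1set.
apply: ler_sum_sub => // W; rewrite subUset => /andP[/andP[_ ->] ->] //.
Qed.

Lemma err_moment_le_pair k V j : err k V * m [set j] <= pair_err k.+1 V j.
Proof.
apply: le_trans (err1_le_pair k.+1 V j); rewrite mulr_suml.
by apply: ler_sum => W _; rewrite mulrC; apply: moment_merge; rewrite cards1.
Qed.

(** Since [j] is adjacent to [V], the union of the two clusters is a cluster containing [V]. A given
    union of size at most [k + 1] comes from at most [4 ^ k.+1] pairs and [k + 1] choices of [j]. *)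
Lemma sum_pair_err k V : 
  \sum_(j | adj V j) pair_err k V j <= (k.+1 * 4 ^ k.+1)%:R * err k V.
Proof.
have [V0|V0] := boolP (V == set0).
  rewrite big1 ?mulr_ge0 ?err_ge0 // => j /exists_inP[i].
  by rewrite (eqP V0) inE.
have step j : adj V j -> pair_err k V j <=
    \sum_(W : {set I} | [&& V \subset W, conn e W & j \in W]) (4 ^ k.+1)%:R * F k W.
  move=> /exists_inP[i iV eij].
  rewrite /pair_err pair_big /=.
  rewrite (partition_big (fun p => p.1 :|: p.2)
     (fun W : {set I} => [&& V \subset W, conn e W & j \in W])) /=; last first.
    move=> [W1 W2] /= /andP[/andP[VW1 c1] /andP[jW2 c2]].
    rewrite (subset_trans VW1 (subsetUl _ _)) inE jW2 orbT andbT /=.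
    by apply: (connU e_sym c1 c2 (subsetP VW1 _ iV) jW2); rewrite eij orbT.
  apply: ler_sum => W _.
  have [leW|gtW] := leqP #|W| k.+1; last first.
    rewrite big1 => [|p /andP[_ /eqP ->]]; first by rewrite mulr_ge0 ?F_ge0.
    exact: F_gt.
  rewrite (eq_bigr (fun=> F k W)) => [|p /andP[_ /eqP <-]] //.
  rewrite sumr_const -[leLHS]mulr_natl ler_wpM2r ?F_ge0 // ler_nat.
  apply: (@leq_trans #|[predX [pred A : {set I} | A \subset W] & [pred A : {set I} | A \subset W]]|).
    apply/subset_leq_card/subsetP => -[W1 W2]; rewrite !inE /= => /andP[_ /eqP <-].
    by rewrite subsetUl subsetUr.
  by rewrite cardX !card_subsets -expnD addnn -mul2n expnM leq_exp2l.
apply: le_trans (ler_sum _ step) _.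
rewrite (exchange_big_dep (fun W : {set I} => (V \subset W) && conn e W)) /=; last first.
  by move=> j W _ /and3P[-> ->].
rewrite /err mulr_sumr; apply: ler_sum => W /andP[VW cW].
have [leW|gtW] := leqP #|W| k.+1; last first.
  rewrite big1 => [|j _]; last by rewrite F_gt // mulr0.
  by apply: mulr_ge0 => //; apply: F_ge0.
rewrite sumr_const -[leLHS]mulr_natl natrM -mulrA.
apply: ler_wpM2r; first by rewrite mulr_ge0 ?F_ge0.
rewrite ler_nat (leq_trans _ leW) //.
by apply/subset_leq_card/subsetP => j; rewrite unfold_in => /and4P[].
Qed.

End ClusterError.

(** * Conditional probabilities and their truncated expansions *)

Lemma sum_sign_conv (R : comNzRingType) (I : finType) (f g : {set I} -> R)
    (S : {set I}) (v k : nat) :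
  \sum_(U : {set I} | (U \subset S) && (v + #|U| <= k)%N) (-1) ^+ #|U| * conv f g U =
  \sum_(A : {set I} | A \subset S)
    \sum_(B : {set I} | [&& B \subset S, (v + #|A| + #|B| <= k)%N & [disjoint A & B]])
      ((-1) ^+ #|A| * f A) * ((-1) ^+ #|B| * g B).
Proof.
rewrite /conv; under eq_bigr => U _ do rewrite mulr_sumr.
rewrite (exchange_big_dep (fun A : {set I} => A \subset S)) /=; last first.
  by move=> U A /andP[US _] AU; apply: subset_trans US.
apply: eq_bigr => A AS.
rewrite (reindex_onto (fun B => A :|: B) (fun U => U :\: A)) /=; last first.
  by move=> U /andP[_ /setIidPr sAU]; rewrite -{2}(setID U A) sAU.
have cdis (B : {set I}) : [disjoint A & B] -> #|A :|: B| = (#|A| + #|B|)%N.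
  by rewrite -setI_eq0 => /eqP d; rewrite cardsU d cards0 subn0.
have eqD B : ((A :|: B) :\: A == B) = [disjoint A & B].
  by rewrite setDUl setDv set0U disjoint_sym; apply/eqP/idP => /setDidPl.
apply: eq_big => [B|B /andP[_]].
  rewrite subUset AS subsetUl andbT eqD /=.
  have [d|] := boolP [disjoint A & B]; last by rewrite !andbF.
  by rewrite cdis // addnA !andbT.
rewrite eqD => d; rewrite cdis // exprD setDUl setDv set0U.
have /setDidPl -> : [disjoint B & A] by rewrite disjoint_sym.
by rewrite mulrACA.
Qed.

Section ClusterRatio.
Variables (R : realFieldType) (I : finType) (e : rel I) (m : {set I} -> R).
Implicit Types (A B C S U V W : {set I}) (i j x : I) (k : nat).
Hypothesis model : cluster_model e m.

(* By inclusion-exclusion, the expectation of [X_V] times the indicator of no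
   [X_i], [i \in S], being 1. *)
Definition avoid V S : R :=
  \sum_(U : {set I} | U \subset S) (-1) ^+ #|U| * m (V :|: U).

Lemma avoid_setU1 V S j : j \notin S ->
  avoid V (j |: S) = avoid V S - avoid (j |: V) S.
Proof.
move=> jS; rewrite /avoid (@big_subset_setU1 _ _ (fun U => (-1) ^+ #|U| * m (V :|: U))) //.
congr (_ + _); rewrite -sumrN; apply: eq_bigr => U US.
rewrite cardsU1 (contra (subsetP US j) jS) /= exprS mulN1r mulNr; congr (- (_ * m _)).
by rewrite setUCA setUA.
Qed.

Lemma avoid_separated V S : separated e V S -> [disjoint V & S] ->
  avoid V S = m V * avoid set0 S.
Proof.
move=> sVS dVS; rewrite /avoid mulr_sumr; apply: eq_bigr => U US.
rewrite set0U (moment_indep model) 1?mulrCA //; first exact: separatedS sVS.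
exact: disjointWr dVS.
Qed.

Hypothesis avoid_gt0 : forall S, 0 < avoid set0 S.
Hypothesis avoid_le : forall V S, 0 <= avoid V S <= m V * avoid set0 S.

(** The conditional probability [q_V(S)] of the overview. *)
Definition ratio V S : R := avoid V S / avoid set0 S.

Lemma ratio_ge0 V S : 0 <= ratio V S.
Proof. by case/andP: (avoid_le V S) => h _; rewrite divr_ge0 // ltW. Qed.

Lemma ratio_le V S : ratio V S <= m V.
Proof. by case/andP: (avoid_le V S) => _; rewrite ler_pdivrMr. Qed.

Lemma ratio_separated V S : separated e V S -> [disjoint V & S] ->
  ratio V S = m V.
Proof.
by move=> sVS dVS; rewrite /ratio avoid_separated // mulfK // gt_eqF.
Qed.

Lemma ratio_setU1 V S j : j \notin S ->
  ratio V (j |: S) - ratio V S =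
  - ratio (j |: V) S + ratio V (j |: S) * ratio [set j] S.
Proof.
move=> jS; have Z0 := avoid_gt0 S; have := avoid_gt0 (j |: S).
rewrite /ratio !avoid_setU1 // setU0 => Z1.
by field; rewrite !gt_eqF.
Qed.

Definition sccum V U : R := (-1) ^+ #|U| * ccum m V U.

(** The cut-off counts [V] too, so moving [j] from [U] into [V] preserves the order. *)
Definition trunc k V S : R :=
  \sum_(U : {set I} | (U \subset S) && (#|V| + #|U| <= k)%N) sccum V U.

Lemma trunc_setU1 k V S j : j \notin S -> j \notin V ->
  trunc k.+1 V (j |: S) - trunc k.+1 V S =
  - trunc k.+1 (j |: V) S +
  \sum_(A : {set I} | A \subset S)
    \sum_(B : {set I} | [&& B \subset S, (#|V| + #|A| + #|B| <= k)%N & [disjoint A & B]])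
      sccum V A * sccum [set j] B.
Proof.
move=> jS jV; rewrite {1 2}/trunc !big_mkcondr /=.
rewrite (@big_subset_setU1 _ _ (fun U => if (#|V| + #|U| <= k.+1)%N then sccum V U else 0)) //.
rewrite addrAC subrr add0r -sum_sign_conv /trunc -sumrN.
rewrite [X in _ = X + _]big_mkcondr [X in _ = _ + X]big_mkcondr -big_split /=.
apply: eq_bigr => U US; have jU := contra (subsetP US j) jS.
rewrite !cardsU1 jU jV /= !add1n addnS addSn ltnS; case: ifP => _; last by rewrite addr0.
rewrite /sccum cardsU1 jU add1n ccumS // ?(moment0 model) // exprS; first by ring.
Qed.

(** Difference of the exact rules for [ratio] and [trunc], with the factors of the product replaced
    by their expansions one at a time. The truncated rule only has disjoint pairs, so the
    overlapping pairs remain as the last sum. *)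
Lemma ratio_err_setU1 k V S j : j \notin S -> j \notin V ->
  (ratio V (j |: S) - trunc k.+1 V (j |: S)) - (ratio V S - trunc k.+1 V S) =
  - (ratio (j |: V) S - trunc k.+1 (j |: V) S)
  + (ratio V (j |: S) - trunc k V (j |: S)) * ratio [set j] S
  + \sum_(A : {set I} | (A \subset j |: S) && (#|V| + #|A| <= k)%N)
      sccum V A * (ratio [set j] S - trunc (k.+1 - (#|V| + #|A|)) [set j] S)
  + \sum_(A : {set I} | A \subset j |: S)
      \sum_(B : {set I} | [&& B \subset S, (#|V| + #|A| + #|B| <= k)%N
                            & ~~ [disjoint A & j |: B]])
        sccum V A * sccum [set j] B.
Proof.
move=> jS jV.
have H1 := ratio_setU1 V jS; have H2 := @trunc_setU1 k _ _ _ jS jV.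
set X := \sum_(A : {set I} | A \subset S) _ in H2.
set Y := \sum_(A : {set I} | (A \subset j |: S) && _) _.
set Z := \sum_(A : {set I} | A \subset j |: S) _.
suff H3 : trunc k V (j |: S) * ratio [set j] S = Y + Z + X by lra.
have -> : Y = trunc k V (j |: S) * ratio [set j] S -
  \sum_(A : {set I} | (A \subset j |: S) && (#|V| + #|A| <= k)%N)
    sccum V A * trunc (k.+1 - (#|V| + #|A|)) [set j] S.
  rewrite /trunc mulr_suml -sumrN -big_split /=; apply: eq_bigr => A _.
  by rewrite mulrBr.
rewrite -addrA -[LHS]addr0; rewrite -addrA; congr (_ + _).
apply/esym/eqP; rewrite addrC subr_eq0; apply/eqP/esym.
rewrite big_mkcondr /=.
(* The order [k.+1 - (#|V| + #|A|)] is chosen for this: as [[set j]] itself counts one, it means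
   [#|V| + #|A| + #|B| <= k]. *)
transitivity (\sum_(A : {set I} | A \subset j |: S)
  \sum_(B : {set I} | (B \subset S) && (#|V| + #|A| + #|B| <= k)%N)
    sccum V A * sccum [set j] B).
  apply: eq_bigr => A AS; case: leqP => leA.
    rewrite /trunc mulr_sumr; apply: eq_bigl => B; rewrite cards1; congr andb.
    by apply/idP/idP; lia.
  by rewrite big_pred0 // => B; apply/negP => /andP[_]; lia.
rewrite (eq_bigr (fun A =>
  \sum_(B : {set I} | [&& B \subset S, (#|V| + #|A| + #|B| <= k)%N & ~~ [disjoint A & j |: B]])
    sccum V A * sccum [set j] B +
  \sum_(B : {set I} | [&& B \subset S, (#|V| + #|A| + #|B| <= k)%N & [disjoint A & j |: B]])
    sccum V A * sccum [set j] B)); last first.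
  move=> A _; rewrite (bigID (fun B => [disjoint A & j |: B])) addrC /=.
  by congr (_ + _); apply: eq_bigl => B; rewrite -andbA.
rewrite big_split /=; congr (_ + _).
rewrite (@big_subset_setU1 _ _ (fun A => \sum_(B : {set I} | [&& B \subset S, (#|V| + #|A| + #|B| <= k)%N
                            & [disjoint A & j |: B]]) sccum V A * sccum [set j] B)) //.
rewrite [X in _ + X]big1 ?addr0; last first.
  move=> A AS; rewrite big_pred0 // => B; rewrite disjoint_sym.
  rewrite -setI_eq0; apply/negP => /and3P[_ _ /eqP/setP/(_ j)].
  by rewrite !inE eqxx.
apply: eq_bigr => A AS; apply: eq_bigl => B; congr [&& _, _ & _].
rewrite -!setI_eq0 setIUr; congr (_ == _).
rewrite (_ : A :&: [set j] = set0) ?set0U //; apply/eqP.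
by rewrite setI_eq0 disjoint_sym disjoints1 (contra (subsetP AS j) jS).
Qed.

End ClusterRatio.

(** * Bounding the error of the truncated expansion *)

Section ClusterBound.
Variables (R : realFieldType) (I : finType) (e : rel I) (m : {set I} -> R).
Implicit Types (A B C S U V W : {set I}) (i j x : I) (k : nat) (K : R).
Hypothesis model : cluster_model e m.
Let e_sym := dep_sym model.
Let m_ge0 := moment_ge0 model.
Hypothesis avoid_gt0 : forall S, 0 < avoid m set0 S.
Hypothesis avoid_le : forall V S, 0 <= avoid m V S <= m V * avoid m set0 S.

Lemma sccum_le V U n : conn e V -> V != set0 -> (#|U| <= n)%N ->
  `|sccum m V U| <= if conn e (V :|: U) then ccum_bound R n * m (V :|: U) else 0.
Proof.
move=> cV V0 leU; rewrite /sccum normrM normrX normrN1 expr1n mul1r.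
case: ifPn => [_|nc]; first exact: (ccum_le model).
by rewrite (ccum_eq0 model cV V0 nc) normr0.
Qed.

Lemma trunc_separated k V S : separated e V S -> [disjoint V & S] ->
  (#|V| <= k)%N -> trunc m k V S = m V.
Proof.
move=> sVS dVS leV; rewrite /trunc (bigD1 set0) /=; last first.
  by rewrite sub0set cards0 addn0.
rewrite big1 ?addr0; first by rewrite /sccum cards0 mul1r ccum0.
move=> U /andP[/andP[US _] U0]; rewrite /sccum -(set0U U).
rewrite (ccum_separated model) ?mulr0 // setU0.
  exact: disjointWr dVS.
exact: separatedS sVS.
Qed.

Lemma trunc_gt k V S : (k < #|V|)%N -> trunc m k V S = 0.
Proof. by move=> ltV; rewrite /trunc big_pred0 // => U; lia. Qed.

Definition ratio_bounded k K := forall V S, conn e V -> V != set0 ->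
  (#|V| <= k.+1)%N -> [disjoint V & S] ->
  `|ratio m V S - trunc m k V S| <= K * err e m k V.

Let G k j W : R := \sum_(W2 : {set I} | (j \in W2) && conn e W2)
    m (W :|: W2) * phi m k (W :|: W2).

Let G_ge0 k j W : 0 <= G k j W.
Proof. by apply: sumr_ge0 => W2 _; rewrite mulr_ge0 ?(phi_ge0 model). Qed.

Lemma setU_inj V (P : pred {set I}) : (forall A, P A -> [disjoint V & A]) ->
  {in P &, injective (fun A => V :|: A)}.
Proof.
move=> d A B /d dA /d dB /(congr1 (fun X => X :\: V)); rewrite !setDUl setDv !set0U.
by move: dA dB; rewrite ![[disjoint V & _]]disjoint_sym => /setDidPl -> /setDidPl ->.
Qed.

Let sum_G k V j S : [disjoint V & S] ->
  \sum_(A : {set I} | (A \subset S) && conn e (V :|: A)) G k j (V :|: A)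
    <= pair_err e m k V j.
Proof.
move=> dVS; apply: (ler_sum_inj (h := fun A => V :|: A)) => //.
  by apply: setU_inj => A /andP[AS _]; apply: disjointWr dVS.
by move=> A /andP[_ ->]; rewrite subsetUl.
Qed.

(** The four summands of the constant match the terms of [ratio_err_setU1]: [K1] for [j |: V], [K]
    for the order-[k] error times a ratio at most [m [set j]], a cumulant bound times [K] for the
    error at [j], and two cumulant bounds for overlapping pairs. *)
Lemma ratio_step k K K1 V S j : conn e V -> V != set0 -> (#|V| <= k.+1)%N ->
  [disjoint V & j |: S] -> j \notin S ->
  0 <= K -> (forall k', (k' <= k)%N -> ratio_bounded k' K) ->
  0 <= K1 -> `|ratio m (j |: V) S - trunc m k.+1 (j |: V) S|
     <= K1 * err e m k.+1 (j |: V) ->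
  `|(ratio m V (j |: S) - trunc m k.+1 V (j |: S)) -
    (ratio m V S - trunc m k.+1 V S)| <=
  (K1 + K + ccum_bound R k * K + ccum_bound R k ^+ 2) * pair_err e m k.+1 V j.
Proof.
move=> cV V0 leV dVjS jS K_ge0 HK K1_ge0 HK1.
have V_gt0 : (0 < #|V|)%N by rewrite card_gt0.
have jV : j \notin V by rewrite (disjointFl dVjS) // setU11.
have j0 : [set j] != set0 by rewrite -card_gt0 cards1.
have djS : [disjoint [set j] & S] by rewrite disjoints1.
set C := ccum_bound R k; have C_ge0 : 0 <= C by exact: ccum_bound_ge0.
set P := pair_err _ _ _ _ _.
rewrite (ratio_err_setU1 model avoid_gt0) //.
apply: le_trans (ler_normD _ _) _; rewrite [leRHS]mulrDl; apply: lerD; last first.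
  apply: le_trans (ler_norm_sum _ _ _) _.
  apply: (@le_trans _ _ (\sum_(A : {set I} | (A \subset j |: S) && conn e (V :|: A))
      C ^+ 2 * G k.+1 j (V :|: A))); last first.
    by rewrite -mulr_sumr ler_wpM2l ?exprn_ge0 // sum_G.
  rewrite [leRHS]big_mkcondr; apply: ler_sum => A AS.
  case: ifPn => [cVA|ncVA]; last first.
    by rewrite big1 ?normr0 // => B _; rewrite /sccum (ccum_eq0 model cV V0 ncVA) mulr0 mul0r.
  apply: le_trans (ler_norm_sum _ _ _) _.
  apply: (@le_trans _ _ (\sum_(B : {set I} | (B \subset S) && conn e (j |: B))
     C ^+ 2 * (m ((V :|: A) :|: (j |: B)) * phi m k.+1 ((V :|: A) :|: (j |: B))))); last first.
    rewrite -mulr_sumr ler_wpM2l ?exprn_ge0 //.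
    apply: (ler_sum_inj (h := fun B => j |: B)
      (f := fun W => m ((V :|: A) :|: W) * phi m k.+1 ((V :|: A) :|: W))).
    - by apply: setU_inj => B /andP[BS _]; apply: disjointWr djS.
    - by move=> B /andP[_ ->]; rewrite setU11.
    - by move=> W _; rewrite mulr_ge0 ?(phi_ge0 model).
  rewrite [leRHS]big_mkcondr.
  apply: (@le_trans _ _ (\sum_(B : {set I} | [&& B \subset S, (#|V| + #|A| + #|B| <= k)%N
      & ~~ [disjoint A & j |: B]])
     (if conn e (j |: B) then C ^+ 2 * (m ((V :|: A) :|: (j |: B)) *
         phi m k.+1 ((V :|: A) :|: (j |: B))) else 0))); last first.
    apply: ler_sum_sub => [B /and3P[]//|B _]; case: ifP => // _.
    by rewrite !mulr_ge0 ?exprn_ge0 ?(phi_ge0 model).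
  apply: ler_sum => B /and3P[BS leAB dAB]; rewrite normrM.
  have leA : (#|A| <= k)%N by move: leAB; clear; lia.
  have leB : (#|B| <= k)%N by move: leAB; clear; lia.
  have := sccum_le cV V0 leA; rewrite cVA => hA.
  have := sccum_le (conn1 e j) j0 leB; case: ifP => [_ hB|_]; last first.
    by rewrite normr_le0 => /eqP ->; rewrite normr0 mulr0.
  apply: le_trans (ler_pM (normr_ge0 _) (normr_ge0 _) hA hB) _.
  rewrite mulrACA -expr2 ler_wpM2l ?exprn_ge0 //.
  move: dAB; rewrite -setI_eq0 => /set0Pn[x]; rewrite inE => /andP[xA xB].
  apply: (moment_merge_overlap model (x := x)) => //; last by rewrite inE xA orbT.
  rewrite cardsU1 (contra (subsetP BS j) jS) cardsU; move: leAB; clear; lia.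
apply: le_trans (ler_normD _ _) _; rewrite [leRHS]mulrDl; apply: lerD; last first.
  apply: le_trans (ler_norm_sum _ _ _) _.
  apply: (@le_trans _ _ (\sum_(A : {set I} | (A \subset j |: S) && conn e (V :|: A))
      C * K * G k.+1 j (V :|: A))); last first.
    by rewrite -mulr_sumr ler_wpM2l ?mulr_ge0 // sum_G.
  rewrite [leRHS]big_mkcondr.
  apply: (@le_trans _ _ (\sum_(A : {set I} | (A \subset j |: S) && (#|V| + #|A| <= k)%N)
     (if conn e (V :|: A) then C * K * G k.+1 j (V :|: A) else 0))); last first.
    apply: ler_sum_sub => [A /andP[]//|A _]; case: ifP => // _.
    by rewrite !mulr_ge0 ?G_ge0.
  apply: ler_sum => A /andP[AS leA]; rewrite normrM.
  have leA' : (#|A| <= k)%N by move: leA; clear; lia.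
  have := sccum_le cV V0 leA'; case: ifP => [_ hA|_]; last first.
    by rewrite normr_le0 => /eqP ->; rewrite normr0 mul0r.
  set k' := (k.+1 - _)%N.
  (* As [V] is nonempty, [k' <= k], so the hypothesis on lower orders applies to [[set j]]. *)
  have hj : `|ratio m [set j] S - trunc m k' [set j] S| <= K * err e m k' [set j].
    by apply: HK; rewrite ?conn1 ?cards1 // /k'; move: leA V_gt0; clear; lia.
  apply: le_trans (ler_pM (normr_ge0 _) (normr_ge0 _) hA hj) _.
  rewrite mulrACA ler_wpM2l ?mulr_ge0 // /err mulr_sumr /G.
  rewrite (eq_bigl (fun W : {set I} => (j \in W) && conn e W)); last first.
    by move=> W; rewrite sub1set.
  apply: ler_sum => W _; apply: (moment_merge model).
  have dVA : V :&: A = set0.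
    by apply/eqP; rewrite setI_eq0; apply: disjointWr AS dVjS.
  rewrite cardsU dVA cards0 /k'; move: leA; clear; lia.
apply: le_trans (ler_normD _ _) _; rewrite [leRHS]mulrDl; apply: lerD.
  rewrite normrN; apply: le_trans HK1 _.
  by rewrite ler_wpM2l // (err_setU1_le_pair model).
rewrite normrM (ger0_norm (ratio_ge0 avoid_gt0 avoid_le _ _)).
have h := HK k (leqnn k) V (j |: S) cV V0 leV dVjS.
apply: le_trans (ler_pM (normr_ge0 _) (ratio_ge0 avoid_gt0 avoid_le _ _) h
  (ratio_le avoid_gt0 avoid_le _ _)) _.
by rewrite -mulrA ler_wpM2l // (err_moment_le_pair model).
Qed.

Lemma ratio_base k V S : #|V| = k.+1 -> conn e V ->
  `|ratio m V S - trunc m k V S| <= err e m k V.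
Proof.
move=> cardV cV; rewrite trunc_gt ?cardV // subr0.
rewrite (ger0_norm (ratio_ge0 avoid_gt0 avoid_le _ _)).
apply: le_trans (ratio_le avoid_gt0 avoid_le _ _) _.
rewrite /err (bigD1 V) /=; last by rewrite subxx.
rewrite {1}/phi cardV eqxx mulr1 lerDl sumr_ge0 // => W _.
by rewrite mulr_ge0 ?(phi_ge0 model).
Qed.

(** Neighbours of [V] are removed from [S] one at a time. Once none is left, [V] is independent of
    [S] and both [ratio] and [trunc] equal [m V]. *)
Lemma ratio_telescope k K K1 V : conn e V -> V != set0 -> (#|V| <= k.+1)%N ->
  0 <= K -> (forall k', (k' <= k)%N -> ratio_bounded k' K) ->
  0 <= K1 -> (forall j S, adj e V j -> j \notin V -> [disjoint j |: V & S] ->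
    `|ratio m (j |: V) S - trunc m k.+1 (j |: V) S|
       <= K1 * err e m k.+1 (j |: V)) ->
  forall S, [disjoint V & S] ->
  `|ratio m V S - trunc m k.+1 V S| <=
  (K1 + K + ccum_bound R k * K + ccum_bound R k ^+ 2) *
    \sum_(j in S | adj e V j) pair_err e m k.+1 V j.
Proof.
move=> cV V0 leV K0 HK K10 HK1 S.
have C0 := ccum_bound_ge0 R k.
set tau := K1 + _ + _ + _.
have [n leS] := ubnP #|S|; elim: n S leS => // n IHn S leS dVS.
have [/existsP[j /andP[jS aj]]|nadj] := boolP [exists j, (j \in S) && adj e V j].
  have jV : j \notin V by rewrite (disjointFl dVS).
  have dVS' : [disjoint V & S :\ j] by apply: disjointWr dVS; apply: subsetDl.
  have ltS : (#|S :\ j| < n)%N by move: leS; rewrite (cardsD1 j) jS.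
  rewrite (bigD1 j) /= ?jS // mulrDr.
  rewrite (eq_bigl (fun i => (i \in S :\ j) && adj e V i)); last first.
    by move=> i; rewrite !inE andbC andbA.
  rewrite -{1 2}(setD1K jS).
  set a := ratio m V (_ |: _) - _; have := IHn _ ltS dVS'.
  set b := ratio m V (_ :\ _) - _ => hb.
  have hab : `|a - b| <= tau * pair_err e m k.+1 V j.
    apply: ratio_step; rewrite ?setD1K ?setD11 //; apply: HK1 => //.
    by rewrite -setI_eq0 setIUl setU_eq0 !setI_eq0 disjoints1 setD11.
  by rewrite -(subrK b a) (le_trans (ler_normD _ _)) // lerD.
have sVS : separated e V S.
  apply/separatedP => i j iV jS; apply/negP => eij.
  by case/existsP: nadj; exists j; rewrite jS; apply/exists_inP; exists i.
rewrite (ratio_separated model) // trunc_separated // subrr normr0 mulr_ge0 //.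
  by rewrite !addr_ge0 ?mulr_ge0 ?exprn_ge0.
by apply: sumr_ge0 => j _; apply: sumr_ge0 => W _; apply: G_ge0.
Qed.

(** Passes from the constant for size [#|V| + 1] to that for size [#|V|]: the constant of
    [ratio_step] times the multiplicity of [sum_pair_err] at order [k + 1]. *)
Definition level_const k K K1 : R := (k.+2 * 4 ^ k.+2)%:R *
  (K1 + K + ccum_bound R k * K + ccum_bound R k ^+ 2).

Lemma level_const_ge0 k K n : 0 <= K -> 0 <= iter n (level_const k K) 1.
Proof.
move=> K0; elim: n => //= n IHn; have C0 := ccum_bound_ge0 R k.
by rewrite mulr_ge0 // !addr_ge0 ?mulr_ge0 ?exprn_ge0.
Qed.

(* Downward induction on [#|V|], starting from size [k + 2], where [trunc] vanishes. *)
Lemma ratio_level k K n V S : 0 <= K ->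
  (forall k', (k' <= k)%N -> ratio_bounded k' K) ->
  (#|V| + n)%N = k.+2 -> conn e V -> V != set0 -> [disjoint V & S] ->
  `|ratio m V S - trunc m k.+1 V S| <=
  iter n (level_const k K) 1 * err e m k.+1 V.
Proof.
move=> K0 HK; elim: n V S => [|n IHn] V S cardV cV V0 dVS.
  by rewrite addn0 in cardV; rewrite mul1r ratio_base.
have K10 := level_const_ge0 k n K0; have C0 := ccum_bound_ge0 R k.
have leV : (#|V| <= k.+1)%N by move: cardV; clear; lia.
have HK1 j (T : {set I}) : adj e V j -> j \notin V -> [disjoint j |: V & T] ->
    `|ratio m (j |: V) T - trunc m k.+1 (j |: V) T|
       <= iter n (level_const k K) 1 * err e m k.+1 (j |: V).
  move=> /exists_inP[i iV eij] jV dT; apply: IHn => //.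
  - by rewrite cardsU1 jV; move: cardV; clear; lia.
  - rewrite setUC; apply: (connU e_sym cV (conn1 e j) iV (set11 j)).
    by rewrite eij orbT.
  - by apply/set0Pn; exists j; rewrite setU11.
apply: le_trans (ratio_telescope cV V0 leV K0 HK K10 HK1 dVS) _.
rewrite iterS; set K1 := iter n _ 1 in K10 *.
rewrite /level_const mulrAC mulrC; apply: ler_wpM2r.
  by rewrite !addr_ge0 ?mulr_ge0 ?exprn_ge0.
apply: le_trans (sum_pair_err model k.+1 V).
apply: ler_sum_sub => [j /andP[]//|j _].
by apply: sumr_ge0 => W _; apply: G_ge0.
Qed.

(** At order [k' + 1] a set of size [k' + 2 - n] needs the [n]-th iterate; the sum serves all sizes
    at once, and the first summand all lower orders. *)
Fixpoint ratio_const k : R := if k is k'.+1 then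
  ratio_const k' + \sum_(n < k'.+2) iter n (level_const k' (ratio_const k')) 1
  else 1.

Lemma ratio_const_ge0 k : 0 <= ratio_const k.
Proof.
by elim: k => //= k IHk; rewrite addr_ge0 // sumr_ge0 // => n _; apply: level_const_ge0.
Qed.

Lemma ratio_boundP k k' : (k' <= k)%N -> ratio_bounded k' (ratio_const k).
Proof.
elim: k k' => [|k IHk] k'; rewrite ?leqn0.
  move=> /eqP -> V S cV V0 leV dVS; rewrite mul1r ratio_base //.
  by apply/eqP; rewrite eqn_leq leV card_gt0.
move=> lek V S cV V0 leV dVS.
have S0 : 0 <= \sum_(n < k.+2) iter n (level_const k (ratio_const k)) 1.
  by apply: sumr_ge0 => n _; rewrite level_const_ge0 // ratio_const_ge0.
have err0 := err_ge0 model k' V.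
rewrite leq_eqVlt ltnS in lek; case/orP: lek => [/eqP ek|lek]; last first.
  by apply: le_trans (IHk _ lek V S cV V0 leV dVS) _; rewrite ler_wpM2r //= lerDl.
rewrite ek in leV err0 *.
have cardV : (#|V| + (k.+2 - #|V|))%N = k.+2 by rewrite subnKC.
apply: le_trans (ratio_level (ratio_const_ge0 k) IHk cardV cV V0 dVS) _.
rewrite ler_wpM2r //=.
have ltn : (k.+2 - #|V| < k.+2)%N by move: V0; rewrite -card_gt0; clear; lia.
rewrite (bigD1 (Ordinal ltn)) //= addrCA lerDl addr_ge0 ?ratio_const_ge0 //.
by apply: sumr_ge0 => i _; rewrite level_const_ge0 // ratio_const_ge0.
Qed.

End ClusterBound.

(** * Joint cumulants and sums over clusters *)

Section JointCumulant.
Variables (R : comNzRingType) (I : finType) (m : {set I} -> R).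
Implicit Types (A B U V W : {set I}) (i j : I).

Definition jcum V : R :=
  \sum_(Q : {set {set I}} | partition Q V)
    (-1) ^+ (#|Q| - 1) * ((#|Q| - 1)`!)%:R * \prod_(P in Q) m P.

(** Group the partitions by the block [i |: A] containing [i]; the signs and factorials left for the
    other blocks are those of [conv_inv]. *)
Lemma jcum_setU1 U i : i \notin U -> jcum (i |: U) = ccum m [set i] U.
Proof.
move=> iU; rewrite /jcum.
pose F (Q : {set {set I}}) : R :=
  (-1) ^+ (#|Q| - 1) * ((#|Q| - 1)`!)%:R * \prod_(P in Q) m P.
rewrite (eq_bigr (fun Q : {set {set I}} => \sum_(A : {set I} | (A \in Q) && (i \in A)) F Q)); last first.
  move=> Q pQ; rewrite [RHS](big_pred1 (pblock Q i)) // => A /=.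
  have tQ : trivIset Q by case/and3P: pQ.
  have iQ : i \in cover Q by rewrite (cover_partition pQ) setU11.
  apply/andP/eqP => [[AQ iA]|->]; first by rewrite (def_pblock tQ AQ iA).
  by rewrite pblock_mem ?mem_pblock.
rewrite (exchange_big_dep (fun A : {set I} => (A \subset i |: U) && (i \in A))) /=; last first.
  move=> Q A pQ /andP[AQ ->]; rewrite andbT -(cover_partition pQ).
  exact: bigcup_sup AQ.
rewrite big_mkcondr /=.
rewrite (@big_subset_setU1 _ _ (fun A => if i \in A then
  \sum_(Q : {set {set I}} | partition Q (i |: U) && ((A \in Q) && (i \in A))) F Q else 0)) //.
rewrite big1 ?add0r; last by move=> A AU; rewrite (negbTE (contra (subsetP AU i) iU)).
rewrite /ccum /conv; apply: eq_bigr => A AU; rewrite setU11.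
have iA0 : i |: A != set0 by apply/set0Pn; exists i; rewrite setU11.
under eq_bigl => Q do rewrite andbT.
rewrite big_partition_block ?setUS // -setDDl setU1K // mulr_sumr.
apply: eq_bigr => Q pQ; have iQ : i |: A \notin Q.
  by apply: (@notin_partition _ _ (i |: U)) iA0 _; rewrite -setDDl setU1K.
by rewrite /F cardsU1 iQ add1n subn1 /= big_setU1 //= mulrCA.
Qed.

End JointCumulant.

Section ClusterSum.
Variables (R : realFieldType) (I : finType) (e : rel I) (m : {set I} -> R).
Implicit Types (A B C S U V W : {set I}) (i j x : I) (k s : nat).
Hypothesis e_sym : symmetric e.
Hypothesis m_ge0 : forall A, 0 <= m A.

(* A connected set of size at least 2 arises from a maximal proper connected
   subset containing [x] by adding one neighbour. *)
Lemma conn_remove W x : conn e W -> x \in W -> (1 < #|W|)%N ->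
  exists j, [/\ j \in W, x \in W :\ j, conn e (W :\ j) & adj e (W :\ j) j].
Proof.
move=> cW xW ltW.
pose P (A : {set I}) := [&& x \in A, conn e A & A \proper W].
have P1 : P [set x].
  rewrite /P set11 conn1 properEcard sub1set xW cards1 //.
case: (@arg_maxnP _ [set x] P (fun A => #|A|) P1) => A /and3P[xA cA AW] maxA.
have A0 : A != set0 by apply/set0Pn; exists x.
have [i [j [iA jWA eij]]] := conn_extend cW AW A0.
move: jWA; rewrite inE => /andP[jA jW].
have cjA : conn e (j |: A).
  by rewrite setUC; apply: (connU e_sym cA (conn1 e j) iA (set11 j)); rewrite eij orbT.
have jAW : j |: A = W.
  apply/eqP/negPn/negP => ne; have := maxA (j |: A).
  rewrite /P inE xA orbT cjA properEneq ne subUset sub1set jW (proper_sub AW) => /(_ isT).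
  by apply/negP; rewrite cardsU1 jA -ltnNge.
exists j; rewrite -jAW setU1K // setU11 xA cA; split=> //.
by apply/exists_inP; exists i.
Qed.

Definition cluster_sum x s : R :=
  \sum_(W : {set I} | [&& x \in W, conn e W & #|W| == s]) m W.

(** Removing a suitable point maps clusters of size [s + 2] injectively to pairs of a cluster of
    size [s + 1] and a neighbour, so each size costs one factor [H]. *)
Lemma cluster_sum_le (H : R) n x : 0 <= H ->
  (forall W, conn e W -> W != set0 -> (#|W| <= n)%N ->
     \sum_(j | (j \notin W) && adj e W j) m (j |: W) <= H * m W) ->
  forall s, (s <= n)%N -> cluster_sum x s.+1 <= H ^+ s * m [set x].
Proof.
move=> H0 grow; elim=> [_|s IHs les].
  rewrite mul1r /cluster_sum (big_pred1 [set x]) // => W /=.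
  apply/and3P/eqP => [[xW _ /cards1P[y Wy]]|->]; last by rewrite set11 conn1 cards1.
  by move: xW; rewrite Wy inE => /eqP ->.
apply: (@le_trans _ _ (\sum_(W : {set I} | [&& x \in W, conn e W & #|W| == s.+1])
    \sum_(j | (j \notin W) && adj e W j) m (j |: W))).
  rewrite /cluster_sum pair_big_dep /=.
  have leafP W : [&& x \in W, conn e W & #|W| == s.+2] -> exists j,
      [/\ j \in W, x \in W :\ j, conn e (W :\ j) & adj e (W :\ j) j].
    by case/and3P => xW cW /eqP cardW; apply: conn_remove; rewrite ?cardW.
  (* A fixed choice of the removable point; the fallback [(W, x)] is never reached for the sets
     summed over. *)
  pose h W := if [pick j | [&& j \in W, x \in W :\ j, conn e (W :\ j) & adj e (W :\ j) j]]
     is Some j then (W :\ j, j) else (W, x).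
  have hP W : [&& x \in W, conn e W & #|W| == s.+2] ->
      exists j, h W = (W :\ j, j) /\ [/\ j \in W, x \in W :\ j, conn e (W :\ j) & adj e (W :\ j) j].
    move=> /leafP[j0 [h1 h2 h3 h4]]; rewrite /h; case: pickP => [j /and4P[]|/(_ j0)].
      by move=> *; exists j.
    by rewrite h1 h2 h3 h4.
  rewrite (eq_bigr (fun W => m ((h W).2 |: (h W).1))); last first.
    by move=> W /hP[j [-> [jW _ _ _]]] /=; rewrite setD1K.
  apply: (ler_sum_inj (h := h) (f := fun p => m (p.2 |: p.1))).
  - move=> W1 W2 /hP[j1 [-> [j1W _ _ _]]] /hP[j2 [-> [j2W _ _ _]]] [eW ej].
    by rewrite -(setD1K j1W) -(setD1K j2W) eW ej.
  - move=> W PW; have [j [-> [jW xW cWj aj]]] := hP W PW.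
    case/and3P: PW => _ _ cardW; rewrite /= xW cWj setD11 aj /= !andbT.
    by move: cardW; rewrite (cardsD1 j) jW.
  - by move=> [].
rewrite exprS -mulrA; apply: le_trans (ler_wpM2l H0 (IHs (ltnW les))).
rewrite /cluster_sum mulr_sumr; apply: ler_sum => W /and3P[xW cW /eqP cardW].
by apply: grow; rewrite ?cardW //; apply/set0Pn; exists x.
Qed.

End ClusterSum.

Section SumErr.
Variables (R : realFieldType) (I : finType) (e : rel I) (m : {set I} -> R).
Implicit Types (A B C S U V W : {set I}) (i j x : I) (k s : nat).
Hypothesis model : cluster_model e m.
Let m_ge0 := moment_ge0 model.

Lemma jcum_eq0 W : W != set0 -> ~~ conn e W -> jcum m W = 0.
Proof.
move=> /set0Pn[i iW] ncW; rewrite -(setD1K iW) jcum_setU1 ?setD11 //.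
apply: (ccum_eq0 model); rewrite ?conn1 ?setD1K //.
by apply/set0Pn; exists i; rewrite set11.
Qed.

(** Each cluster is counted at most [k + 1] times. For sizes up to [k], expanding [mu] and summing
    first over the clusters through [x] gives a multiple of [m [set x] ^+ 2]. *)
Lemma sum_err_le (H : R) k : 0 <= H ->
  (forall x s, (s < k)%N -> cluster_sum e m x s.+1 <= H * m [set x]) ->
  \sum_i err e m k [set i] <=
  k.+1%:R * (\sum_(W : {set I} | (#|W| == k.+1) && conn e W) m W +
             k%:R * H * \sum_i m [set i] ^+ 2).
Proof.
move=> H0 HH.
rewrite /err (exchange_big_dep (fun W => conn e W)) /=; last by move=> i W _ /andP[].
apply: (@le_trans _ _ (\sum_(W : {set I} | conn e W) k.+1%:R * (m W * phi m k W))).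
  apply: ler_sum => W cW; have F0 : 0 <= m W * phi m k W by rewrite mulr_ge0 ?(phi_ge0 model).
  have [gtW|leW] := ltnP k.+1 #|W|.
    by rewrite big1 ?(mulr_ge0 _ F0) // => i _; rewrite /phi gtn_eqF // leqNgt (ltnW gtW) mulr0.
  rewrite sumr_const -[leLHS]mulr_natl; apply: ler_wpM2r => //.
  rewrite ler_nat (leq_trans _ leW) //; apply/subset_leq_card/subsetP => i.
  by rewrite unfold_in sub1set => /andP[].
rewrite -mulr_sumr ler_wpM2l //.
rewrite (bigID (fun W : {set I} => #|W| == k.+1)) /=; apply: lerD.
  rewrite (eq_bigl (fun W : {set I} => (#|W| == k.+1) && conn e W)); last by move=> W; rewrite andbC.
  by apply: ler_sum => W /andP[cW _]; rewrite /phi cW mulr1.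
apply: (@le_trans _ _ (\sum_(W : {set I} | conn e W && (#|W| <= k)%N) \sum_(x in W) m W * m [set x])).
  rewrite [leLHS]big_mkcondr [leRHS]big_mkcondr; apply: ler_sum => W cW.
  rewrite -mulr_sumr /phi; case: eqP => [->|_] /=; first by rewrite ltnn.
  by case: ifP => _ //; rewrite mulr0.
rewrite (exchange_big_dep predT) //= mulr_sumr; apply: ler_sum => x _.
rewrite -mulr_suml expr2 mulrA; apply: ler_wpM2r => //.
rewrite -mulrA mulr_natl -[k in leRHS]card_ord -sumr_const.
apply: le_trans (ler_sum _ (fun (s : 'I_k) _ => HH x s (ltn_ord s))).
rewrite /cluster_sum (exchange_big_dep (fun W => conn e W && (x \in W))) /=; last first.
  by move=> s W _ /and3P[-> ->].
rewrite [leLHS](eq_bigl (fun W => (conn e W && (x \in W)) && (#|W| <= k)%N)); last first.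
  by move=> W; rewrite andbAC.
rewrite [leLHS]big_mkcondr; apply: ler_sum => W /andP[cW xW].
have W0 : (0 < #|W|)%N by rewrite card_gt0; apply/set0Pn; exists x.
case: ifP => leW; last by apply: sumr_ge0.
have lt : (#|W|.-1 < k)%N by move: leW W0; clear; lia.
have eqW : #|W| == #|W|.-1.+1 by rewrite prednK.
rewrite (bigD1 (Ordinal lt)) /=; last by rewrite xW cW eqW.
by rewrite lerDl sumr_ge0.
Qed.

End SumErr.

(** * Random subsets and hypergraphs *)

Section EdgeMoment.
Variables (R : realFieldType) (T J : finType) (g : J -> {set T}).
Implicit Types (A B V W S U : {set J}) (i j : J) (Y : {set T}) (v : T) (x p : R).

Definition cov W : {set T} := \bigcup_(i in W) g i.

Definition meet_rel : rel J := [rel i j | (i != j) && (g i :&: g j != set0)].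

(** The base [x] is kept free because it is also taken to be a rescaled [p], possibly above 1. *)
Definition edge_moment x W : R := x ^+ #|cov W|.

Lemma cov0 : cov set0 = set0. Proof. by rewrite /cov big_set0. Qed.

Lemma cov1 i : cov [set i] = g i. Proof. by rewrite /cov big_set1. Qed.

Lemma covU A B : cov (A :|: B) = cov A :|: cov B.
Proof. exact: bigcup_setU. Qed.

Lemma covS A B : A \subset B -> cov A \subset cov B.
Proof. by move=> /setUidPr <-; rewrite covU subsetUl. Qed.

Lemma covU1 j W : cov (j |: W) = g j :|: cov W.
Proof. by rewrite covU cov1. Qed.

Lemma meet_rel_sym : symmetric meet_rel.
Proof. by move=> i j; rewrite /meet_rel /= eq_sym setIC. Qed.

Lemma edge_moment_model p : 0 <= p <= 1 -> cluster_model meet_rel (edge_moment p).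
Proof.
move=> /andP[p0 p1]; split.
- exact: meet_rel_sym.
- by rewrite /edge_moment cov0 cards0.
- by move=> A; apply: exprn_ge0.
- move=> A B AB; apply: ler_wiXn2l => //; exact/subset_leq_card/covS.
- move=> A B; rewrite /edge_moment -!exprD; apply: ler_wiXn2l => //.
  rewrite -(cardsUI (cov A) (cov B)) covU leq_add2l; apply: subset_leq_card.
  by rewrite subsetI !covS ?subsetIl ?subsetIr.
- move=> A B /separatedP sAB dAB; rewrite /edge_moment covU cardsU.
  rewrite (_ : cov A :&: cov B = set0) ?cards0 ?subn0 ?exprD //.
  apply/eqP; rewrite -subset0; apply/subsetP => v; rewrite inE => /andP[].
  move=> /bigcupP[i iA vi] /bigcupP[j jB vj].
  have := sAB i j iA jB; rewrite /= negb_and !negbK => /orP[/eqP ij|/eqP gij].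
    by rewrite -ij (disjointFr dAB iA) in jB.
  by rewrite -gij inE vi.
Qed.

Variables (r : nat) (x M : R).
Hypothesis g_inj : injective g.
Hypothesis g_le : forall j, (#|g j| <= r)%N.
Hypothesis x_ge0 : 0 <= x.
Hypothesis M_ge0 : 0 <= M.
Hypothesis codeg_le : forall Y s, Y != set0 -> (0 < s)%N ->
  #|[set j | (Y \subset g j) && (#|g j| == #|Y| + s)%N]|%:R * x ^+ s <= M.

(** Split by the excess size [s]: for [s = 0] only the edge [Y] itself can occur, and each of the
    [r] positive values contributes at most [M]. *)
Lemma sum_codeg_le Y : Y != set0 ->
  \sum_(j | Y \subset g j) x ^+ (#|g j| - #|Y|) <= 1 + r%:R * M.
Proof.
move=> Y0.
rewrite (partition_big (fun j => inord (#|g j| - #|Y|) : 'I_r.+1) predT) //=.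
have cst (s : 'I_r.+1) :
    \sum_(j | (Y \subset g j) && (inord (#|g j| - #|Y|) == s)) x ^+ (#|g j| - #|Y|) =
    #|[set j | (Y \subset g j) && (#|g j| == #|Y| + s)%N]|%:R * x ^+ s.
  rewrite mulr_natl -sumr_const; apply: eq_big => [j|j /andP[_ /eqP <-]].
    rewrite !inE; have [Yg|//] := boolP (Y \subset g j); rewrite /= -val_eqE /=.
    have leY := subset_leq_card Yg; have leg := g_le j.
    rewrite inordK; last by rewrite ltnS (leq_trans _ leg) ?leq_subr.
    by move: leY; clear; lia.
  by rewrite inordK // ltnS (leq_trans _ (g_le j)) ?leq_subr.
rewrite (eq_bigr _ (fun s _ => cst s)) big_ord_recl; apply: lerD.
  rewrite expr0 mulr1 -[leRHS]/1%:R ler_nat; apply/card_le1_eqP => i j.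
  rewrite !inE /= addn0 => /andP[Yi /eqP ci] /andP[Yj /eqP cj]; apply: g_inj.
  have /eqP <- : Y == g i by rewrite eqEcard Yi ci leqnn.
  by have /eqP <- : Y == g j by rewrite eqEcard Yj cj leqnn.
rewrite mulr_natl -[r in leRHS]card_ord -sumr_const; apply: ler_sum => s _.
exact: codeg_le.
Qed.

Lemma card_cov_le W : (#|cov W| <= r * #|W|)%N.
Proof.
rewrite mulnC -sum_nat_const /cov; elim/big_rec2: _ => [|i n Y _ le]; first by rewrite cards0.
by rewrite cardsU (leq_trans (leq_subr _ _)) // leq_add.
Qed.

(** Sort the new edges by their nonempty trace [Y] on [cov g W]: there are at most [2 ^ (r * n)]
    traces, and [sum_codeg_le] bounds the sum for each. *)
Lemma edge_moment_grow W n : (#|W| <= n)%N ->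
  \sum_(j | (j \notin W) && adj meet_rel W j) edge_moment x (j |: W)
    <= (2 ^ (r * n))%:R * (1 + r%:R * M) * edge_moment x W.
Proof.
move=> leW.
have rM : 0 <= 1 + r%:R * M by rewrite addr_ge0 ?mulr_ge0.
have em j : edge_moment x (j |: W) = edge_moment x W * x ^+ (#|g j| - #|g j :&: cov W|).
  rewrite /edge_moment -exprD covU1 cardsU; congr (_ ^+ _).
  by rewrite addnBA ?subset_leq_card ?subsetIl // addnC.
under eq_bigr => j _ do rewrite em.
rewrite -mulr_sumr [leRHS]mulrC; apply: ler_wpM2l; first exact: exprn_ge0.
apply: (@le_trans _ _ (\sum_(Y : {set T} | (Y \subset cov W) && (Y != set0))
   \sum_(j | Y \subset g j) x ^+ (#|g j| - #|Y|))).
  rewrite pair_big_dep /=.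
  apply: (ler_sum_inj (h := fun j => (g j :&: cov W, j))
    (f := fun u => x ^+ (#|g u.2| - #|u.1|))).
  - by move=> i j _ _ [].
  - move=> j /andP[_ /exists_inP[i iW /= /andP[_ gij]]].
    rewrite subsetIr subsetIl andbT /=.
    case/set0Pn: gij => v; rewrite inE => /andP[vi vj]; apply/set0Pn; exists v.
    by rewrite inE vj; apply/bigcupP; exists i.
  - by move=> u _; apply: exprn_ge0.
apply: (@le_trans _ _ (\sum_(Y : {set T} | Y \subset cov W) (1 + r%:R * M))).
  rewrite [leLHS]big_mkcondr; apply: ler_sum => Y _; case: ifP => // Y0.
  exact: sum_codeg_le.
rewrite sumr_const -[leLHS]mulr_natl; apply: ler_wpM2r => //.
rewrite ler_nat card_subsets leq_exp2l // (leq_trans (card_cov_le W)) //.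
by rewrite leq_mul2l leW orbT.
Qed.

End EdgeMoment.

(** * Moments and avoidance probabilities of the binomial random subset *)

Section BinomialMoment.
Variables (R : realType) (T J : finType) (g : J -> {set T}) (p : R).
Hypothesis p01 : 0 < p < 1.
Implicit Types (A V S : {set J}) (i j : J) (Y : {set T}) (v : T) (f : {set T} -> R).

Lemma binomial_weight_gt0 Y : 0 < binomial_weight p Y.
Proof.
case/andP: p01 => p0 p1; apply: prodr_gt0 => v _.
by case: ifP => _ //; rewrite subr_gt0.
Qed.

Lemma Expect1 : Expect p (fun _ : {set T} => 1) = 1.
Proof.
rewrite /Expect; under eq_bigr => Y _ do rewrite mulr1.
rewrite /binomial_weight -(bigA_distr _ _ (fun=> p) (fun=> 1 - p)).
by rewrite big1 // => v _; rewrite /= addrC subrK.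
Qed.

Lemma Expect_mem v f :
  Expect p (fun Y => (v \in Y)%:R * f Y) = p * Expect p (fun Y => f (v |: Y)).
Proof.
have split (F : {set T} -> R) : \sum_Y F Y =
    \sum_(Y : {set T} | Y \subset [set~ v]) F Y + \sum_(Y : {set T} | Y \subset [set~ v]) F (v |: Y).
  rewrite -big_subset_setU1 ?inE ?eqxx //; apply: eq_bigl => Y.
  by apply/esym/subsetP => y _; rewrite !inE orbN.
rewrite /Expect !split mulrDr !mulr_sumr -!big_split; apply: eq_bigr => Y Yv /=.
have vY : v \notin Y by move: Yv; rewrite subsetC sub1set inE.
rewrite setU11 (negbTE vY) setUA setUid mul0r mulr0 add0r mul1r.
rewrite /binomial_weight (bigD1 v) //= setU11 [X in _ = _ * (X * _) + _](bigD1 v) //= (negbTE vY).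
rewrite (eq_bigr (fun u => if u \in Y then p else 1 - p)); first by ring.
by move=> u /negbTE uv; rewrite !inE uv.
Qed.

Lemma Expect_subset Y f :
  Expect p (fun Y' => (Y \subset Y')%:R * f Y') =
  p ^+ #|Y| * Expect p (fun Y' => f (Y :|: Y')).
Proof.
have [n] := ubnP #|Y|; elim: n Y f => // n IHn Y f ltY.
have [->|/set0Pn[v vY]] := eqVneq Y set0.
  rewrite cards0 mul1r; apply: eq_bigr => Y' _.
  by rewrite sub0set set0U mul1r.
have ltD : (#|Y :\ v| < n)%N by move: ltY; rewrite (cardsD1 v) vY.
transitivity (Expect p (fun Y' => (v \in Y')%:R * ((Y :\ v \subset Y')%:R * f Y'))).
  apply: eq_bigr => Y' _; congr (_ * _); rewrite mulrA -natrM mulnb -sub1set -subUset.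
  by rewrite setD1K.
rewrite Expect_mem (cardsD1 v) vY exprS -mulrA.
transitivity (p * Expect p (fun Y' => (Y :\ v \subset Y')%:R * f (v |: Y'))).
  congr (_ * _); apply: eq_bigr => Y' _; congr (_ * (_ %:R * _)).
  by rewrite !subDset setUA setUid.
rewrite IHn //; congr (_ * (_ * _)); apply: eq_bigr => Y' _.
by rewrite setUA setD1K.
Qed.

Definition hits V Y : R := \prod_(i in V) (g i \subset Y)%:R.

Definition misses S Y : R := \prod_(i in S) (1 - (g i \subset Y)%:R).

Lemma hitsE V Y : hits V Y = (cov g V \subset Y)%:R.
Proof.
rewrite /hits /cov; elim/big_rec2: _ => [|i Z y _ ->]; first by rewrite sub0set.
by rewrite -natrM mulnb subUset.
Qed.

Lemma Expect_hits V : Expect p (hits V) = edge_moment g p V.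
Proof.
transitivity (Expect p (fun Y => (cov g V \subset Y)%:R * 1)).
  by apply: eq_bigr => Y _; rewrite hitsE mulr1.
by rewrite Expect_subset Expect1 mulr1.
Qed.

Lemma missesS S Y Y' : Y \subset Y' -> 0 <= misses S Y' <= misses S Y.
Proof.
move=> YY'.
have h i : 0 <= 1 - (g i \subset Y')%:R :> R by case: (_ \subset _); rewrite ?subrr ?subr0.
apply/andP; split; first by apply: prodr_ge0 => i _; apply: h.
apply: ler_prod => i _; rewrite h lerD2l lerN2 ler_nat.
by have [/subset_trans/(_ YY') ->|] := boolP (g i \subset Y).
Qed.

(** Inclusion-exclusion, by the recursion [avoid_setU1], which the right-hand side satisfies as
    well. *)
Lemma avoidE V S : avoid (edge_moment g p) V S =
  Expect p (fun Y => (cov g V \subset Y)%:R * misses S Y).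
Proof.
have [n] := ubnP #|S|; elim: n V S => // n IHn V S ltS.
have [->|/set0Pn[j jS]] := eqVneq S set0.
  rewrite /avoid (big_pred1 set0) ?cards0 ?setU0 ?mul1r; last by move=> U; rewrite subset0.
  rewrite -Expect_hits; apply: eq_bigr => Y _.
  by rewrite /misses big_set0 mulr1 hitsE.
have ltD : (#|S :\ j| < n)%N by move: ltS; rewrite (cardsD1 j) jS.
rewrite -{1}(setD1K jS) avoid_setU1 ?setD11 // !IHn // /Expect -sumrB.
apply: eq_bigr => Y _; rewrite -mulrBr; congr (_ * _).
rewrite /misses [in RHS](big_setD1 j jS) /= covU1 subUset -mulnb natrM; ring.
Qed.

(** A case of Harris' inequality: conditioning on containing [cov g V] amounts to adding these
    vertices, which can only lower [misses]. *)
Lemma avoid_edge_le V S :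
  0 <= avoid (edge_moment g p) V S <=
    edge_moment g p V * avoid (edge_moment g p) set0 S.
Proof.
case/andP: p01 => p0 p1; have w0 Y := ltW (binomial_weight_gt0 Y).
rewrite !avoidE Expect_subset; apply/andP; split.
  rewrite mulr_ge0 ?exprn_ge0 ?(ltW p0) // sumr_ge0 // => Y _.
  by rewrite mulr_ge0 //; case/andP: (missesS S (subxx (cov g V :|: Y))).
apply: ler_wpM2l; first by rewrite exprn_ge0 ?ltW.
apply: ler_sum => Y _; apply: ler_wpM2l => //.
rewrite cov0 sub0set mul1r.
by case/andP: (missesS S (subsetUr (cov g V) Y)).
Qed.

(** The empty vertex set has positive weight and contains no nonempty edge. *)
Lemma avoid_edge_gt0 S : (forall j, g j != set0) -> 0 < avoid (edge_moment g p) set0 S.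
Proof.
move=> g0; rewrite avoidE /Expect (bigD1 set0) //= ltr_wpDr //.
  apply: sumr_ge0 => Y _; rewrite mulr_ge0 ?(ltW (binomial_weight_gt0 _)) // mulr_ge0 //.
  by case/andP: (missesS S (subxx Y)).
rewrite cov0 subxx mul1r mulr_gt0 ?binomial_weight_gt0 // /misses.
apply: prodr_gt0 => i _; rewrite subset0 (negbTE (g0 i)) subr0 //.
Qed.

End BinomialMoment.

(** * The logarithm of the avoidance probability *)

Lemma ln1B_bound (R : realType) (x : R) : 0 <= x <= 1 / 2 ->
  `|ln (1 - x) + x| <= 2 * x ^+ 2.
Proof.
move=> /andP[x0 x2]; have x1 : 0 < 1 - x by lra.
have h1 : ln (1 - x) <= - x by apply: le_ln1Dx; lra.
(* The lower bound on the logarithm is an upper bound for the logarithm of the reciprocal. *)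
have h2 : - ln (1 - x) <= x / (1 - x).
  rewrite -lnV ?posrE //.
  have e : (1 - x)^-1 = 1 + x / (1 - x) by field; rewrite gt_eqF.
  rewrite [X in ln X]e.
  by apply: le_ln1Dx; rewrite (lt_le_trans (ltrN10 R)) // divr_ge0 // ltW.
have h3 : x / (1 - x) <= x + 2 * x ^+ 2.
  rewrite ler_pdivrMr //; nra.
by rewrite ler0_norm; [lra | lra].
Qed.

Section LogAvoid.
Variables (R : realType) (I : finType) (e : rel I) (m : {set I} -> R).
Implicit Types (A B C S U V W : {set I}) (i j x : I) (k : nat).
Hypothesis model : cluster_model e m.
Hypothesis avoid_gt0 : forall S, 0 < avoid m set0 S.
Hypothesis avoid_le : forall V S, 0 <= avoid m V S <= m V * avoid m set0 S.

(** The truncated cumulant series of [ln (avoid m set0 S)], kept for every [S] so that points can be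
    added one at a time. *)
Definition tcum k S : R :=
  \sum_(W : {set I} | (W \subset S) && (0 < #|W| <= k)%N) (-1) ^+ #|W| * jcum m W.

Lemma tcum_setU1 k S i : i \notin S ->
  tcum k (i |: S) = tcum k S - trunc m k [set i] S.
Proof.
move=> iS; rewrite /tcum !big_mkcondr /=.
rewrite (@big_subset_setU1 _ _ (fun W => if (0 < #|W| <= k)%N then (-1) ^+ #|W| * jcum m W else 0)) //.
congr (_ + _); rewrite /trunc big_mkcondr -sumrN; apply: eq_bigr => U US.
have iU := contra (subsetP US i) iS.
rewrite cardsU1 iU cards1 /= add1n; case: ifP => _; last by rewrite oppr0.
by rewrite jcum_setU1 // exprS mulN1r mulNr.
Qed.

(** Adding [i] multiplies the avoidance probability by 1 - q and subtracts a [trunc] from [tcum].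
    The error is that of [trunc] as an approximation of q, plus 2q^2 from the logarithm. *)
Lemma ln_avoid_le k S : (forall i, m [set i] <= 1 / 2) ->
  `|ln (avoid m set0 S) - tcum k S| <=
  \sum_(i in S) (ratio_const R k * err e m k [set i] + 2 * m [set i] ^+ 2).
Proof.
move=> m2; have [n] := ubnP #|S|; elim: n S => // n IHn S ltS.
have [->|/set0Pn[i iS]] := eqVneq S set0.
  rewrite big_set0 /avoid (big_pred1 set0); last by move=> U; rewrite subset0.
  rewrite cards0 setU0 mul1r (moment0 model) ln1 /tcum big_pred0 ?subrr ?normr0 //.
  by move=> W; apply/negP; rewrite subset0 => /andP[/eqP ->]; rewrite cards0.
have ltD : (#|S :\ i| < n)%N by move: ltS; rewrite (cardsD1 i) iS.
rewrite (big_setD1 i iS) /= -{1 2}(setD1K iS).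
have iD : i \notin S :\ i by rewrite setD11.
rewrite tcum_setU1 // avoid_setU1 // setU0.
set S' := S :\ i; have Z0 := avoid_gt0 S'; pose q := ratio m [set i] S'.
have -> : avoid m set0 S' - avoid m [set i] S' = avoid m set0 S' * (1 - q).
  by rewrite /q /ratio; field; rewrite gt_eqF.
have q0 : 0 <= q by exact: ratio_ge0.
have qm : q <= m [set i] by exact: ratio_le.
have q2 : q <= 1 / 2 := le_trans qm (m2 i).
have q01 : 0 <= q <= 1 / 2 by rewrite q0.
rewrite lnM ?posrE //; last by lra.
have i0 : [set i] != set0 by rewrite -card_gt0 cards1.
have i1 : (#|[set i]| <= k.+1)%N by rewrite cards1.
have dS : [disjoint [set i] & S'] by rewrite disjoints1.
have b1 := ratio_boundP model avoid_gt0 avoid_le (leqnn k) (conn1 e i) i0 i1 dS.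
have b2 := ln1B_bound q01; have b3 := IHn _ ltD.
have b4 : q ^+ 2 <= m [set i] ^+ 2 by rewrite ler_sqr ?nnegrE ?(moment_ge0 model).
rewrite -/q in b1.
set a := ln (avoid _ _ _) in b3 *; set b := ln (1 - q) in b2 *.
set t := tcum _ _ in b3 *; set c := trunc _ _ _ _ in b1 *.
have -> : a + b - (t - c) = (a - t) + (b + q) - (q - c) by ring.
apply: le_trans (ler_normB _ _) _.
apply: le_trans (lerD (ler_normD _ _) (lexx _)) _.
rewrite -/S' in b3 *; lra.
Qed.

(** Only connected sets remain, as the other cumulants vanish. *)
Lemma tcum_setT k : tcum k setT =
  \sum_(1 <= i < k.+1) (-1) ^+ i *
    \sum_(W : {set I} | (#|W| == i) && conn e W) jcum m W.
Proof.
rewrite big_add1 /= big_mkord.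
rewrite (eq_bigr (fun s : 'I_k => \sum_(W : {set I} | (#|W| == s.+1) && conn e W)
   (-1) ^+ #|W| * jcum m W)); last first.
  by move=> s _; rewrite mulr_sumr; apply: eq_bigr => W /andP[/eqP ->].
rewrite (exchange_big_dep (fun W : {set I} => (0 < #|W| <= k)%N)) /=; last first.
  by move=> s W _ /andP[/eqP -> _]; rewrite ltn_ord.
rewrite /tcum; apply: eq_big => [W|W /andP[_ /andP[W0 Wk]]]; first by rewrite subsetT.
have lt : (#|W|.-1 < k)%N by rewrite prednK.
have [cW|ncW] := boolP (conn e W); last first.
  rewrite [RHS]big_pred0 => [|s]; last by rewrite andbF.
  by rewrite (jcum_eq0 model) ?mulr0 // -card_gt0.
rewrite (big_pred1 (Ordinal lt)) // => s; rewrite /= andbT -val_eqE /=.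
by move: W0; clear; lia.
Qed.

Lemma ln_avoid_expansion (H : R) k : 0 <= H ->
  (forall i, m [set i] <= 1 / 2) ->
  (forall x s, (s < k)%N -> cluster_sum e m x s.+1 <= H * m [set x]) ->
  `|ln (avoid m set0 setT) - \sum_(1 <= i < k.+1) (-1) ^+ i *
      \sum_(W : {set I} | (#|W| == i) && conn e W) jcum m W| <=
  (ratio_const R k * k.+1%:R * (1 + k%:R * H) + 2) *
    (\sum_i m [set i] ^+ 2 + \sum_(W : {set I} | (#|W| == k.+1) && conn e W) m W).
Proof.
move=> H0 m2 HH; rewrite -tcum_setT; apply: le_trans (ln_avoid_le k setT m2) _.
rewrite (eq_bigl predT) => [|i]; last by rewrite in_setT.
rewrite big_split /= -!mulr_sumr.
have c0 := ratio_const_ge0 R k; have := sum_err_le model H0 HH.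
set d := \sum_i m [set i] ^+ 2; set D := \sum_(W | _) m W.
have d0 : 0 <= d by apply: sumr_ge0 => i _; apply: exprn_ge0; apply: moment_ge0 model _.
have D0 : 0 <= D by apply: sumr_ge0 => i _; apply: moment_ge0 model _.
have kH : 0 <= k%:R * H by rewrite mulr_ge0.
move=> /(ler_wpM2l c0) h; rewrite [leRHS]mulrDl; apply: lerD; last first.
  by rewrite ler_wpM2l // lerDl.
apply: le_trans h _; rewrite -!mulrA ler_wpM2l // ler_wpM2l //.
by rewrite mulrDl mul1r mulrDr [d + D]addrC; rewrite !lerD //; nra.
Qed.

End LogAvoid.

(** * The cluster model of a hypergraph *)

Section HypergraphModel.
Variables (R : realType) (G : hypergraph).
Implicit Types (V W : {set 'I_(nedges G)}) (i j : 'I_(nedges G)) (p x y : R)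
  (Y : {set vertex G}) (k r s : nat).

Local Notation cconn := (conn (meet_rel (@edge G))).
Local Notation mom := (edge_moment (@edge G)).

Lemma edge_inj : injective (@edge G). Proof. exact: enum_val_inj. Qed.

Lemma edge_neq0 j : edge j != set0.
Proof.
by apply: contraNneq (edges_neq0 G) => <-; apply: enum_valP.
Qed.

(** A side of a cut is closed under the induced relation; conversely, the points reachable from [i]
    form a side of a cut unless they exhaust [V]. *)
Lemma induced_connectedE V : induced_connected V = cconn V.
Proof.
apply/idP/idP => [/forall_inP cV|cV].
  apply/negPn/negP => /connPn[A [AV A0 neA /separatedP sA]].
  have /properP[_ [j jV jA]] : A \proper V by rewrite properEneq neA.
  case/set0Pn: A0 => i iA.
  have cij := forall_inP (cV i (subsetP AV i iA)) j jV.
  have symV : symmetric (induced V).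
    by move=> u w; rewrite /induced /= [dep u w]meet_rel_sym andbCA.
  have clA : closed (induced V) (mem A).
    apply: (intro_closed (sym_connect_sym symV)) => u w /and3P[uV wV euw] uA.
    apply/negPn/negP => wA; have := sA u w uA; rewrite inE wA wV => /(_ isT).
    by move/negP; apply; exact: euw.
  by move: (closed_connect clA cij); rewrite iA (negbTE jA).
apply/forall_inP => i iV; apply/forall_inP => j jV.
pose A := [set u in V | connect (induced V) i u].
have AV : A \subset V by apply/subsetP => u; rewrite inE => /andP[].
have [AeV|neA] := eqVneq A V.
  by have : j \in A; [rewrite AeV | rewrite inE => /andP[]].
have A0 : A != set0 by apply/set0Pn; exists i; rewrite inE iV connect0.
have AprV : A \proper V by rewrite properEneq neA.
have [u [w [uA wA euw]]] := conn_extend cV AprV A0.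
move: uA wA; rewrite !inE => /andP[uV iu] /andP[wA wV].
case/negP: wA; rewrite wV; apply: connect_trans iu _; apply: connect1.
by apply/and3P; split.
Qed.

Lemma expect_indicators p V : 0 < p < 1 -> Expect p (indicators R V) = mom p V.
Proof. by move=> p01; apply: Expect_hits. Qed.

Lemma expect_indicator p i : 0 < p < 1 -> Expect p (indicator R i) = mom p [set i].
Proof.
move=> p01; rewrite -expect_indicators //; apply: eq_bigr => Y _.
by rewrite /indicators big_set1.
Qed.

Lemma DeltaE p k : 0 < p < 1 ->
  Delta G p k = \sum_(W : {set 'I_(nedges G)} | (#|W| == k) && cconn W) mom p W.
Proof.
move=> p01; apply: eq_big => [W|W _]; last exact: expect_indicators.
by rewrite inE induced_connectedE.
Qed.

Lemma kappaE p k : 0 < p < 1 -> kappa G p k =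
  \sum_(W : {set 'I_(nedges G)} | (#|W| == k) && cconn W) jcum (mom p) W.
Proof.
move=> p01; apply: eq_big => [W|W _]; first by rewrite inE induced_connectedE.
apply: eq_bigr => Q _; congr (_ * _); apply: eq_bigr => P _.
exact: expect_indicators.
Qed.

Lemma delta1E p : 0 < p < 1 -> delta1 G p = \sum_i mom p [set i] ^+ 2.
Proof. by move=> p01; apply: eq_bigr => i _; rewrite expect_indicator. Qed.

Lemma ProbE p : 0 < p < 1 ->
  Prob p (fun Y : {set vertex G} => count_edges Y == 0%N) = avoid (mom p) set0 setT.
Proof.
move=> p01; rewrite avoidE // /Prob big_mkcond; apply: eq_bigr => Y _.
rewrite cov0 sub0set mul1r /misses.
have [/eqP|c0] := boolP (count_edges Y == 0%N).
  move=> /eqP; rewrite cards_eq0 => /eqP c0; rewrite big1 ?mulr1 // => i _.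
  have : edge i \notin [set g in edges G | g \subset Y] by rewrite c0 inE.
  by rewrite inE enum_valP /= => /negbTE ->; rewrite subr0.
move: c0; rewrite cards_eq0 => /set0Pn[g]; rewrite inE => /andP[gG gY].
rewrite (bigD1 (enum_rank_in gG g)) //= /edge enum_rankK_in // gY subrr mul0r.
by rewrite mulr0.
Qed.

Lemma D_ge0 x : 0 <= D G x.
Proof. exact: bigmax_ge_id. Qed.

Lemma codegree_le_D x Y s : 0 <= x -> Y != set0 -> (0 < s)%N ->
  #|[set j | (Y \subset edge j) && (#|edge j| == #|Y| + s)%N]|%:R * x ^+ s <= D G x.
Proof.
move=> x0 Y0 s0.
have le_codeg : (#|[set j : 'I_(nedges G) | (Y \subset edge j) && (#|edge j| == #|Y| + s)%N]|
    <= codegree s Y)%N.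
  rewrite -(card_imset _ edge_inj); apply/subset_leq_card/subsetP => g.
  by case/imsetP => j; rewrite inE => jP ->; rewrite inE enum_valP.
have [lesT|gtsT] := leqP s #|vertex G|; last first.
  rewrite (_ : [set j | _] = set0) ?cards0 ?mul0r ?D_ge0 //; apply/setP => j.
  rewrite !inE; apply/negP => /andP[_ /eqP cj]; have := max_card (edge j).
  rewrite cj; move: gtsT; clear; lia.
apply: (@le_trans _ _ ((codegree s Y)%:R * x ^+ s)).
  by rewrite ler_wpM2r ?exprn_ge0 // ler_nat.
apply: (@bigmax_sup_seq _ _ _ _ _ s) => //; first by rewrite mem_index_iota s0 ltnS.
exact: (bigmax_sup Y).
Qed.

Section Sparse.
Variables (r : nat).
Hypothesis edges_le : forall g : {set vertex G}, g \in edges G -> (#|g| <= r)%N.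

Let edge_le j : (#|edge j| <= r)%N.
Proof. by apply: edges_le; apply: enum_valP. Qed.

Definition growth (M : R) k : R := (2 ^ (r * k))%:R * (1 + r%:R * M).

Lemma growth_ge1 M k : 0 <= M -> 1 <= growth M k.
Proof.
move=> M0; have a1 : 1 <= (2 ^ (r * k))%:R :> R by rewrite ler1n expn_gt0.
have b1 : 1 <= 1 + r%:R * M by rewrite lerDl mulr_ge0.
by rewrite /growth; apply: le_trans a1 _; rewrite ler_peMr.
Qed.

Lemma edge_cluster_sum_le x M k i s : 0 <= x -> 0 <= M ->
  (forall Y s, Y != set0 -> (0 < s)%N ->
    #|[set j | (Y \subset edge j) && (#|edge j| == #|Y| + s)%N]|%:R * x ^+ s <= M) ->
  (s <= k)%N ->
  cluster_sum (meet_rel (@edge G)) (mom x) i s.+1 <= growth M k ^+ k * mom x [set i].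
Proof.
move=> x0 M0 HM lesk; have g1 := growth_ge1 k M0.
have mx0 W : 0 <= mom x W by apply: exprn_ge0.
apply: (@le_trans _ _ (growth M k ^+ s * mom x [set i])); last first.
  by rewrite ler_wpM2r // ler_weXn2l.
apply: (@cluster_sum_le _ _ _ _ (@meet_rel_sym _ _ _) mx0 _ k) => //.
  exact: le_trans g1.
by move=> W cW W0 leW; apply: edge_moment_grow leW => //; apply: edge_inj.
Qed.

Lemma ln_Prob_expansion p M k : 0 < p < 1 -> p <= 1 / 2 -> 0 <= M -> D G p <= M ->
  `|ln (Prob p (fun Y : {set vertex G} => count_edges Y == 0%N)) -
    \sum_(1 <= i < k.+1) (-1) ^+ i * kappa G p i| <=
  (ratio_const R k * k.+1%:R * (1 + k%:R * growth M k ^+ k) + 2) *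
    (delta1 G p + Delta G p k.+1).
Proof.
move=> p01 p2 M0 DM; case/andP: (p01) => p0 p1.
rewrite ProbE // delta1E // DeltaE //.
under eq_bigr => i _ do rewrite kappaE //.
apply: ln_avoid_expansion.
- by apply: edge_moment_model; rewrite !ltW.
- by move=> S; apply: avoid_edge_gt0 => // j; apply: edge_neq0.
- by move=> V S; apply: avoid_edge_le.
- by rewrite exprn_ge0 // (le_trans _ (growth_ge1 k M0)).
(* Edges are nonempty, so a single-edge moment is at most [p]. *)
- move=> i; apply: le_trans p2; rewrite /edge_moment cov1 -[leRHS]expr1.
  by apply: ler_wiXn2l; rewrite ?ltW // card_gt0 edge_neq0.
- move=> i s lts; apply: (edge_cluster_sum_le _ (ltW p0) M0 _ (ltnW lts)) => Y s' Y0 s0.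
  by apply: le_trans DM; apply: codegree_le_D => //; apply: ltW.
Qed.

(** The edges of [W] are distinct subsets of their union. *)
Lemma card_cov_log W L : (2 ^ L <= #|W|)%N -> (L <= #|cov (@edge G) W|)%N.
Proof.
move=> leW; rewrite -(@leq_exp2l 2) // (leq_trans leW) // -card_powerset.
rewrite -(card_imset _ edge_inj); apply/subset_leq_card/subsetP => g /imsetP[j jW ->].
by rewrite inE; apply: bigcup_sup.
Qed.

(** Charge each edge to its vertices; the edges through one vertex contribute [x] times a codegree
    sum. *)
Lemma sum_edge_moment1_le x M : 0 <= x -> 0 <= M ->
  (forall Y s, Y != set0 -> (0 < s)%N ->
    #|[set j | (Y \subset edge j) && (#|edge j| == #|Y| + s)%N]|%:R * x ^+ s <= M) ->
  \sum_i mom x [set i] <= #|vertex G|%:R * (x * (1 + r%:R * M)).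
Proof.
move=> x0 M0 HM.
apply: (@le_trans _ _ (\sum_(v : vertex G)
   \sum_(i | [set v] \subset edge i) x * x ^+ (#|edge i| - #|[set v]|))).
  rewrite (exchange_big_dep predT) //=; apply: ler_sum => i _.
  case/set0Pn: (edge_neq0 i) => v vi; rewrite (bigD1 v) ?sub1set //=.
  rewrite cards1 -exprS subn1 prednK ?card_gt0 ?edge_neq0 //.
  rewrite /edge_moment cov1 lerDl sumr_ge0 // => w _.
  by rewrite mulr_ge0 ?exprn_ge0.
rewrite mulr_natl -sumr_const; apply: ler_sum => v _.
rewrite -mulr_sumr ler_wpM2l //.
by apply: sum_codeg_le => //; [exact: edge_inj | rewrite -card_gt0 cards1].
Qed.

(* Rescaling [p] to [p / y] keeps the codegrees bounded by 1, while a cluster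
   of [k + 1] edges covers at least [L] vertices, which gains [y ^+ L]. *)
Lemma Delta_le p y k L : 0 < p < 1 -> 0 < y <= 1 -> D G p <= y ^+ r ->
  (2 ^ L <= k.+1)%N ->
  Delta G p k.+1 <=
    growth 1 k ^+ k * (1 + r%:R) * (#|vertex G|%:R * (p / y) * y ^+ L).
Proof.
move=> p01 /andP[y0 y1] Dy leL; case/andP: (p01) => p0 p1.
pose x := p / y; have x0 : 0 <= x by rewrite divr_ge0 ?ltW.
have px : p = x * y by rewrite /x divfK // gt_eqF.
have HM Y s : Y != set0 -> (0 < s)%N ->
    #|[set j | (Y \subset edge j) && (#|edge j| == #|Y| + s)%N]|%:R * x ^+ s <= 1.
  (* No edge has excess above [r]; for [s <= r] the bound [y ^+ r <= y ^+ s] absorbs the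
     rescaling. *)
  move=> Y0 s0; have [ltrs|lesr] := ltnP r s.
    rewrite (_ : [set j | _] = set0) ?cards0 ?mul0r //; apply/setP => j; rewrite !inE.
    apply/negP => /andP[_ /eqP cj]; have := edge_le j.
    rewrite cj; move: ltrs; clear; lia.
  have h := codegree_le_D (ltW p0) Y0 s0.
  rewrite -(@ler_pM2r _ (y ^+ s)) ?exprn_gt0 // mul1r -mulrA -exprMn -px.
  apply: le_trans h (le_trans Dy _).
  by apply: ler_wiXn2l => //; apply: ltW.
rewrite DeltaE //.
have mx0 W : 0 <= mom x W by apply: exprn_ge0.
apply: (@le_trans _ _ ((\sum_(W : {set 'I_(nedges G)} | (#|W| == k.+1) && cconn W) mom x W) * y ^+ L)).
  rewrite mulr_suml; apply: ler_sum => W /andP[/eqP cW _].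
  rewrite /edge_moment px exprMn ler_wpM2l ?exprn_ge0 //.
  by apply: ler_wiXn2l => //; [apply: ltW | rewrite card_cov_log // cW].
rewrite !mulrA; apply: ler_wpM2r; first by rewrite exprn_ge0 ?ltW.
rewrite -[_ * p / y]mulrA -/x -mulrA -mulrA.
apply: (@le_trans _ _ (\sum_i cluster_sum (meet_rel (@edge G)) (mom x) i k.+1)).
  rewrite /cluster_sum (exchange_big_dep predT) //= [leRHS](bigID (fun W => (#|W| == k.+1) && cconn W)) /=.
  apply: ler_wpDr; first by apply: sumr_ge0 => W _; apply: sumr_ge0.
  apply: ler_sum => W /andP[cW cc]; have /set0Pn[i iW] : W != set0.
    by rewrite -card_gt0 (eqP cW).
  by rewrite (bigD1 i) ?iW ?cc ?cW //= lerDl sumr_ge0.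
apply: (@le_trans _ _ (\sum_i growth 1 k ^+ k * mom x [set i])).
  by apply: ler_sum => i _; apply: edge_cluster_sum_le.
rewrite -mulr_sumr; apply: ler_wpM2l.
  by rewrite exprn_ge0 // (le_trans _ (growth_ge1 k ler01)).
apply: le_trans (sum_edge_moment1_le x0 ler01 HM) _.
by rewrite le_eqVlt; apply/orP; left; apply/eqP; ring.
Qed.

End Sparse.

End HypergraphModel.

From mathcomp Require Import all_classical all_reals all_analysis.
Import Order.TTheory GRing.Theory Num.Theory.
Import numFieldNormedType.Exports.

(** * Asymptotics *)

Local Open Scope classical_set_scope.

Lemma limn_esup_lty_bounded (R : realType) (u : nat -> R) :
  (limn_esup (fun n => (u n)%:E) < +oo)%E ->
  exists2 M : R, 0 <= M & \forall n \near \oo, u n <= M.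
Proof.
move=> /ereal_inf_lt[_ [V FV <-] ltV].
have ub n : V n -> ((u n)%:E <= ereal_sup [set (u n)%:E | n in V])%E.
  by move=> Vn; apply: ereal_sup_ubound; exists n.
exists (Num.max 0 (fine (ereal_sup [set (u n)%:E | n in V]))).
  by rewrite le_max lexx.
apply: filterS FV => n /ub; move: ltV; case: ereal_sup => [s _| |]//.
by rewrite lee_fin /= le_max => ->; rewrite orbT.
Qed.

Lemma Delta_cvg0 (R : realType) (r : nat) (eps : R) : (0 < r)%N -> 0 < eps ->
  exists2 k : nat, (0 < k)%N &
  forall (G : nat -> hypergraph) (p : nat -> R), sparse_sequence r G p ->
  (\forall n \near \oo, D (G n) (p n) <= #|vertex (G n)|%:R `^ (- eps)) ->
  Delta (G n) (p n) k.+1 @[n --> \oo] --> 0.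
Proof.
move=> r0 eps0; have rR0 : 0 < r%:R :> R by rewrite ltr0n.
(* With y = N^(-eps/r), a value of [L] above r/eps makes N y^L at most 1. *)
pose L := Num.bound (r%:R / eps); have ltL : r%:R / eps < L%:R :> R.
  by apply: archi_boundP; rewrite divr_ge0 // ltW.
(* Clusters of [2 ^ L.+1] edges gain [y ^+ L.+1]; the additional factor [y] pays for the division in
   [p / y], so that C p remains as the bound. *)
pose k := (2 ^ L.+1).-1; have kS : k.+1 = (2 ^ L.+1)%N by rewrite prednK // expn_gt0.
exists k; first by rewrite -ltnS kS expnS leq_pmulr // expn_gt0.
move=> G p [edges_le p01 p0 _] HD.
pose C : R := growth r 1 k ^+ k * (1 + r%:R).
have C0 : 0 <= C.
  by rewrite mulr_ge0 ?addr_ge0 // exprn_ge0 // (le_trans _ (growth_ge1 _ _ ler01)).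
apply: (@squeeze_cvgr _ _ _ _ (fun=> 0) (fun n => C * p n)); last 2 first.
- exact: cvg_cst.
- by rewrite -(mulr0 C); apply: cvgMr.
near=> n.
have HDn : D (G n) (p n) <= #|vertex (G n)|%:R `^ (- eps) by near: n.
have pn := p01 n; case/andP: (pn) => pn0 pn1.
have mom0 (W : {set 'I_(nedges (G n))}) : 0 <= edge_moment (@edge (G n)) (p n) W.
  by rewrite exprn_ge0 // ltW.
apply/andP; split; first by rewrite DeltaE // sumr_ge0.
(* Without vertices there are no nonempty edges, so the cluster sum is empty. *)
set N := #|vertex (G n)|; have [N0|N0] := posnP N.
  rewrite DeltaE // big_pred0 ?(mulr_ge0 C0 (ltW pn0)) // => W; apply/negP => /andP[/eqP cW _].
  have /card_gt0P[i _] : (0 < #|W|)%N by rewrite cW.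
  have : (0 < #|edge i|)%N by rewrite card_gt0 edge_neq0.
  by rewrite ltnNge; apply/negP/negPn; rewrite -N0 max_card.
have N1 : 1 <= N%:R :> R by rewrite ler1n.
have Npos : 0 < N%:R :> R by rewrite ltr0n.
pose y : R := N%:R `^ (- eps / r%:R).
have y0 : 0 < y by exact: powR_gt0.
have y1 : y <= 1.
  rewrite -(powRr0 N%:R); apply: ler_powR => //.
  by rewrite mulNr oppr_le0 divr_ge0 // ltW.
have yr : y ^+ r = N%:R `^ (- eps).
  by rewrite -powR_mulrn ?(ltW y0) // -powRrM divfK // gt_eqF.
have yL : N%:R * y ^+ L <= 1.
  rewrite -powR_mulrn ?(ltW y0) // -powRrM.
  apply: (@le_trans _ _ (N%:R * N%:R `^ (-1))).
    apply: ler_wpM2l; first exact: ltW.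
    apply: ler_powR => //; rewrite !mulNr lerN2 mulrAC ler_pdivlMr // mul1r.
    by rewrite ltr_pdivrMr // mulrC in ltL; rewrite ltW.
  by rewrite powR_inv1 ?(ltW Npos) // divff // gt_eqF.
have Dn : D (G n) (p n) <= y ^+ r by rewrite yr.
have y01 : 0 < y <= 1 by rewrite y0.
have leL : (2 ^ L.+1 <= k.+1)%N by rewrite kS.
apply: le_trans (Delta_le (edges_le n) pn y01 Dn leL) _.
rewrite -/C; apply: ler_wpM2l => //.
have -> : N%:R * (p n / y) * y ^+ L.+1 = p n * (N%:R * y ^+ L).
  by rewrite exprS; field; rewrite gt_eqF.
by rewrite ler_piMr // ltW.
Unshelve. all: by end_near.
Qed.

Lemma Prob_expansion (R : realType) (r : nat) (G : nat -> hypergraph) (p : nat -> R)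
    (k : nat) : sparse_sequence r G p ->
  exists E : nat -> R,
    E =O_\oo (fun n => delta1 (G n) (p n) + Delta (G n) (p n) k.+1) /\
    forall n : nat,
      Prob (p n) (fun S : {set vertex (G n)} => count_edges S == 0%N) =
      expR (\sum_(1 <= i < k.+1) (-1) ^+ i * kappa (G n) (p n) i + E n).
Proof.
move=> [edges_le p01 p0 /limn_esup_lty_bounded[M M0 HM]].
pose X n := Prob (p n) (fun S : {set vertex (G n)} => count_edges S == 0%N).
pose K n := \sum_(1 <= i < k.+1) (-1) ^+ i * kappa (G n) (p n) i.
(* With the exact difference as [E] the identity holds for every [n]; only the bound needs [n]
   large, so that [p n <= 1 / 2] and [D] is at most [M]. *)
exists (fun n => ln (X n) - K n); split; last first.
  move=> n; rewrite -/(K n) addrC subrK lnK // posrE /X ProbE //.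
  by apply: avoid_edge_gt0 => // j; apply: edge_neq0.
pose C : R := ratio_const R k * k.+1%:R * (1 + k%:R * growth r M k ^+ k) + 2.
have C0 : 0 < C.
  have g0 : 0 <= growth r M k by exact: le_trans (growth_ge1 _ _ M0).
  by rewrite ltr_wpDl // !mulr_ge0 ?ratio_const_ge0 ?addr_ge0 ?mulr_ge0 ?exprn_ge0.
apply/eqO_exP; exists C => //.
near=> n; have pn := p01 n; case/andP: (pn) => pn0 pn1.
have p2 : p n <= 1 / 2.
  by near: n; apply: (cvgr_le _ p0); rewrite divr_gt0.
have Dn : D (G n) (p n) <= M by near: n.
apply: le_trans (ln_Prob_expansion (edges_le n) k pn p2 M0 Dn) _.
by apply: ler_wpM2l; [exact: ltW | exact: ler_norm].
Unshelve. all: by end_near.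
Qed.

(* The order of quantifiers in the second part makes k depend on eps and r
   only. *)
Theorem theorem1p10 (R : realType) (r : nat) (r_gt0 : (0 < r)%N) :
  (forall (G : nat -> hypergraph) (p : nat -> R), sparse_sequence r G p ->
   forall k : nat,
   exists E : nat -> R,
     E =O_\oo (fun n => delta1 (G n) (p n) + Delta (G n) (p n) k.+1) /\
     forall n : nat,
       Prob (p n) (fun S : {set vertex (G n)} => count_edges S == 0%N) =
       expR (\sum_(1 <= i < k.+1) (-1) ^+ i * kappa (G n) (p n) i + E n))
  /\
  (forall eps : R, 0 < eps ->
   exists2 k : nat, (0 < k)%N &
   forall (G : nat -> hypergraph) (p : nat -> R), sparse_sequence r G p ->
   (\forall n \near \oo, D (G n) (p n) <= #|vertex (G n)|%:R `^ (- eps)) ->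
   Delta (G n) (p n) k.+1 @[n --> \oo] --> 0).
Proof.
split=> [G p Gp k|eps eps0]; first exact: Prob_expansion Gp.
exact: Delta_cvg0.
Qed.
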